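(* Let $\{(N_n,B_n)\}_{n=1}^\infty$ be a sequence of admissible pairs in $\mathbb{R}$ with $N_n>0$ satisfying the remainder bounded condition $\sum_{n=1}^{\infty}\frac{\#B_{n,2}}{\#B_n}<\infty$, where $B_{n,1}=B_n\cap\{0,1,\dots,N_n-1\}$ and $B_{n,2}=B_n\setminus B_{n,1}$. Suppose there exists a subsequence $\{(N_{n_k},B_{n_k})\}_{k=1}^\infty$ satisfying the partial concentration condition. Then the infinite convolution $$\mu=\delta_{N_1^{-1}B_1}*\delta_{(N_2N_1)^{-1}B_2}*\cdots*\delta_{(N_n\cdots N_2N_1)^{-1}B_n}*\cdots$$ exists and is a spectral measure.
   Context: An admissible pair in $\mathbb{R}$ is a pair $(N,B)$ where $N$ is an integer with $|N|>1$ and $B\subseteq\mathbb{Z}$ is finite with $\#B\ge2$, such that there exists $L\subseteq\mathbb{Z}$ with $\#L=\#B$ for which the matrix $\big[\frac{1}{\sqrt{\#B}}e^{-2\pi i (b/N)\ell}\big]_{b\in B,\ell\in L}$ is unitary. Partial concentration condition (PCC): a sequence $\{(M_k,D_k)\}_{k=1}^\infty$ satisfies PCC if for some $l\in(0,1)$ one of the following holds: (i) there are reals $d_{k,1},d_{k,2}\in[0,M_k-1]$ with $0<\frac{d_{k,2}-d_{k,1}}{M_k}<l$ for all $k$ such that $\sum_{k=1}^\infty\frac{\#D^l_{k,2}}{\#D_k}<\infty$, where $D^l_{k,1}=D_k\cap[d_{k,1},d_{k,2}]$ and $D^l_{k,2}=D_k\setminus D^l_{k,1}$; or (ii) there exist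 $c\in(0,1]$ and reals $d_{k,1},d_{k,2}\in[\frac{l}{2}M_k,(1-\frac{l}{2})M_k]$ such that $\frac{\#(D_k\cap[d_{k,1},d_{k,2}])}{\#D_k}\ge c$ for all $k\in\mathbb{N}$. For finite $A\subseteq\mathbb{R}$, $\delta_A=\frac{1}{\#A}\sum_{a\in A}\delta_a$; $*$ is convolution. The infinite convolution is the weak limit (if it exists) of $\mu_n=\delta_{N_1^{-1}B_1}*\cdots*\delta_{(N_n\cdots N_1)^{-1}B_n}$. A Borel probability measure $\mu$ on $\mathbb{R}$ is spectral if there is a countable $\Lambda\subseteq\mathbb{R}$ such that $\{e^{-2\pi i\lambda x}:\lambda\in\Lambda\}$ is an orthonormal basis of $L^2(\mu)$. *)

(* Defs.v *)
From HB Require Import structures.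
From mathcomp Require Import all_boot all_order all_algebra.
From mathcomp Require Import all_classical all_reals all_analysis.
From mathcomp Require Import complex.
Set Implicit Arguments. Unset Strict Implicit. Unset Printing Implicit Defensive.
Import Order.TTheory GRing.Theory Num.Theory.
Import numFieldNormedType.Exports.
Local Open Scope ring_scope.
Local Open Scope classical_set_scope.

Definition cexpi (R : realType) (t : R) : R[i] := Complex (cos t) (sin t).

Definition admissible (R : realType) (N : int) (B : seq int) : Prop :=
  (1 < `|N|)%R /\ uniq B /\ (2 <= size B)%N /\
  exists L : seq int, uniq L /\ size L = size B /\
    let n := size B in
    let U : 'M[R[i]]_n := \matrix_(i < n, j < n)
        (Complex ((Num.sqrt (n%:R : R))^-1) 0 *
          cexpi (- (2 * pi) * (((B`_i)%:~R / (N%:~R)) * (L`_j)%:~R))) in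
    U *m (map_mx conjc U)^T = 1%:M.

Definition rem_card (N : int) (B : seq int) : nat :=
  count (fun b : int => ~~ ((0 <= b) && (b < N))) B.

Definition PCC (R : realType) (M : nat -> int) (D : nat -> seq int) : Prop :=
  exists l : R, 0 < l < 1 /\
  ( (exists d1 d2 : nat -> R,
       (forall k, 0 <= d1 k <= (M k)%:~R - 1 /\ 0 <= d2 k <= (M k)%:~R - 1 /\
                  0 < (d2 k - d1 k) / (M k)%:~R < l) /\
       cvg (series (fun k => (count (fun b : int =>
                   ~~ ((d1 k <= b%:~R) && (b%:~R <= d2 k))) (D k))%:R
                 / (size (D k))%:R : R) @ \oo))
  \/
    (exists c : R, 0 < c <= 1 /\
     exists d1 d2 : nat -> R, forall k,
       l / 2 * (M k)%:~R <= d1 k <= (1 - l / 2) * (M k)%:~R /\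
       l / 2 * (M k)%:~R <= d2 k <= (1 - l / 2) * (M k)%:~R /\
       c <= (count (fun b : int => (d1 k <= b%:~R) && (b%:~R <= d2 k)) (D k))%:R
            / (size (D k))%:R)).

(* The sequence is indexed from 0: (N 0, B 0) is (N_1, B_1).
   cumN N n = N_{n+1} ... N_1 (as an integer). *)
Definition cumN (N : nat -> int) (n : nat) : int := \prod_(j < n.+1) N j.

(* Atoms (with multiplicity) of mu_n = delta_{N_1^{-1}B_1} * ... * delta_{(N_n...N_1)^{-1}B_n}:
   all sums  b_1/N_1 + b_2/(N_2 N_1) + ... + b_n/(N_n...N_1), b_j in B_j. *)
Fixpoint conv_atoms (R : realType) (N : nat -> int) (B : nat -> seq int) (n : nat)
  : seq R :=
  match n with
  | 0 => [:: 0]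
  | m.+1 => [seq x + (b%:~R / (cumN N m)%:~R) | x <- conv_atoms R N B m, b <- B m]
  end.

Definition conv_integral (R : realType) (N : nat -> int) (B : nat -> seq int)
  (n : nat) (f : R -> R) : R :=
  (size (conv_atoms R N B n))%:R^-1 * \sum_(x <- conv_atoms R N B n) f x.

Definition infinite_convolution_is (R : realType) (N : nat -> int)
  (B : nat -> seq int) (mu : probability R R) : Prop :=
  forall f : R -> R, continuous f -> (exists C : R, forall x, `|f x| <= C) ->
    ((fun n => (conv_integral N B n f)%:E) @ \oo --> (\int[mu]_x (f x)%:E)%E).

(* mu is spectral: some countable Lambda such that {e_lambda(x) = e^{-2 pi i lambda x}}
   is an orthonormal basis of L^2(mu) (complex valued).  A complex function
   f = u + i v is written via its real and imaginary parts.
   Orthonormality: <e_l, e_l'> = int e^{-2 pi i (l - l') x} dmu = [l = l'].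
   Completeness: f in L^2(mu) with <f, e_l> = int f(x) e^{2 pi i l x} dmu = 0
   for all l in Lambda is 0 mu-a.e. *)
Definition spectral (R : realType) (mu : probability R R) : Prop :=
  exists Lambda : set R, countable Lambda /\
  (forall l l', Lambda l -> Lambda l' ->
     (\int[mu]_x (cos (2 * pi * (l - l') * x))%:E = (if l == l' then 1 else 0)%:E)%E /\
     (\int[mu]_x (sin (2 * pi * (l - l') * x))%:E = 0)%E) /\
  (forall u v : R -> R, measurable_fun setT u -> measurable_fun setT v ->
     mu.-integrable setT (fun x => (u x ^+ 2)%:E) ->
     mu.-integrable setT (fun x => (v x ^+ 2)%:E) ->
     (forall l, Lambda l ->
        (\int[mu]_x (u x * cos (2 * pi * l * x) - v x * sin (2 * pi * l * x))%:E = 0)%E /\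
        (\int[mu]_x (u x * sin (2 * pi * l * x) + v x * cos (2 * pi * l * x))%:E = 0)%E) ->
     {ae mu, forall x, u x = 0 /\ v x = 0}).

(* Main.v *)
(* Proof idea.  Write P_n = N_1 ... N_n, and mu^ for the characteristic function
   of a measure mu.

   Existence: reading the atoms of mu_n along the mixed-radix digits of a uniform
   t in [0, 1] realizes mu_n as the law of X_n(t).  By Borel-Cantelli almost every t
   has only finitely many digits outside {0, ..., N_n - 1}; from then on X_n(t) is
   nondecreasing and X_n(t) + 1 / P_n nonincreasing, so X_n converges almost surely.

   Spectrum: choosing 0 in each L_n and reducing lam + P_n l to its representative
   in [-P_(n+1) / 2, P_(n+1) / 2) gives nested spectra Lam_n of mu_n whose elements
   satisfy |lam| <= P_n / 2.  Now mu^ (xi + lam) is mu_n^ (xi + lam) times the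
   transform of the digit tail at (xi + lam) / P_n, a point of [-1/2 - d, 1/2 + d].
   At the indices of the partial concentration condition this tail transform is
   bounded below there: after recentring at t0, its real part is the expectation of
   cos (2 pi x (t - t0)), where t0 is the centre of the interval of concentration,
   or 1/2 when mass stays away from 0 and 1.  Hence the Parseval sums of mu_n are
   dominated by those of mu and pass to the limit, so that every character lies in
   the closed span of the spectrum; characters are total in L^2 (mu). *)

Require Import Defs.
From HB Require Import structures.
From mathcomp Require Import all_boot all_order all_algebra.
From mathcomp Require Import all_classical all_reals all_analysis.
From mathcomp Require Import measurable_realfun.
From mathcomp Require Import complex.
From mathcomp Require Import ring lra zify.
Import Order.TTheory GRing.Theory Num.Theory.
Import numFieldNormedType.Exports.
Local Open Scope ring_scope.
Local Open Scope classical_set_scope.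
Set Implicit Arguments.
Unset Strict Implicit.
Unset Printing Implicit Defensive.

(** * Expectation over finitely many digits *)

Section DigitExpectation.
Context (R : realType) (N : nat -> int) (B : nat -> seq int).

Definition avg (s : seq int) (f : int -> R) : R :=
  (size s)%:R^-1 * \sum_(b <- s) f b.

(** The law of the sum of b_j / (N_s ... N_j) over s <= j < s + m, with independent uniform digits
    b_j in B_j. Recursion on the first digit displays the tail from s + 1 rescaled by N_s, the form
    used for the estimates on tails. *)
Fixpoint dexp (s m : nat) (f : R -> R) : R :=
  if m is m'.+1 then
    avg (B s) (fun b => dexp s.+1 m' (fun y => f ((b%:~R + y) / (N s)%:~R)))
  else f 0.

Lemma eq_avg s f g : f =1 g -> avg s f = avg s g.
Proof. by move=> fg; rewrite /avg; under eq_bigr do rewrite fg. Qed.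

Lemma avgD s f g : avg s (fun b => f b + g b) = avg s f + avg s g.
Proof. by rewrite /avg big_split mulrDr. Qed.

Lemma avgZ s c f : avg s (fun b => c * f b) = c * avg s f.
Proof. by rewrite /avg -mulr_sumr mulrCA. Qed.

Lemma ler_avg s f g : {in s, forall b, f b <= g b} -> avg s f <= avg s g.
Proof.
move=> fg; rewrite /avg ler_wpM2l ?invr_ge0// !big_seq.
exact: ler_sum.
Qed.

Lemma avg_cst s c : (0 < size s)%N -> avg s (fun=> c) = c.
Proof.
move=> s0; rewrite /avg big_const_seq count_predT iter_addr_0 -(mulr_natl c).
by rewrite mulrA mulVf ?mul1r// pnatr_eq0 -lt0n.
Qed.

Lemma avg_count s (p : pred int) :
  avg s (fun b => (p b)%:R) = (count p s)%:R / (size s)%:R.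
Proof.
rewrite /avg -sum1_count natr_sum mulrC [in RHS]big_mkcond /=.
by congr (_ * _); apply: eq_bigr => b _; case: (p b).
Qed.

Lemma eq_dexp s m f g : f =1 g -> dexp s m f = dexp s m g.
Proof.
by elim: m s f g => [|m IH] s f g fg //=; apply: eq_avg => b; apply: IH => y.
Qed.

Lemma dexpD s m f g : dexp s m (fun y => f y + g y) = dexp s m f + dexp s m g.
Proof.
elim: m s f g => [|m IH] s f g //=.
by rewrite -avgD; apply: eq_avg => b; rewrite -IH.
Qed.

Lemma dexpZ s m c f : dexp s m (fun y => c * f y) = c * dexp s m f.
Proof.
elim: m s f => [|m IH] s f //=.
by rewrite -avgZ; apply: eq_avg => b; rewrite -IH.
Qed.

Lemma ler_dexp s m f g : (forall y, f y <= g y) -> dexp s m f <= dexp s m g.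
Proof.
elim: m s f g => [|m IH] s f g fg //=.
by apply: ler_avg => b _; apply: IH => y.
Qed.

(** Peeling off the last digit instead of the first brings the recursion in line with [conv_atoms],
    which grows at the end. *)
Lemma dexp_rcons s m f : dexp s m.+1 f =
  dexp s m (fun x => avg (B (s + m)%N) (fun b =>
    f (x + b%:~R / (\prod_(s <= j < (s + m).+1) N j)%:~R))).
Proof.
elim: m s f => [|m IH] s f.
  rewrite /= addn0 big_nat1; apply: eq_avg => b.
  by rewrite addr0 add0r.
rewrite -[LHS]/(avg (B s) (fun b => dexp s.+1 m.+1
  (fun y => f ((b%:~R + y) / (N s)%:~R)))).
rewrite [RHS]/=; apply: eq_avg => b; rewrite IH; apply: eq_dexp => x.
rewrite addSnnS; apply: eq_avg => b'; congr f.
rewrite [in RHS]big_ltn ?ltnS ?leq_addr// intrM invfM mulrA mulrDl.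
by rewrite mulrDl mulrDl addrA -!mulrA [_^-1 * _]mulrC.
Qed.

Lemma conv_integral_dexp n f : conv_integral N B n f = dexp 0 n f.
Proof.
elim: n f => [|n IH] f.
  by rewrite /conv_integral /= big_seq1 invr1 mul1r.
rewrite dexp_rcons -IH /conv_integral /= size_allpairs natrM invfM -mulrA.
congr (_ * _); rewrite big_allpairs_dep mulr_sumr; apply: eq_bigr => x _.
by rewrite /avg add0n /cumN big_mkord.
Qed.

Hypothesis B0 : forall n, (0 < size (B n))%N.

Lemma dexp_cst s m c : dexp s m (fun=> c) = c.
Proof.
by elim: m s => [|m IH] s //=; rewrite IH; apply: avg_cst.
Qed.

End DigitExpectation.

(** * Characteristic functions and spectra of the finite convolutions *)

Section CharacteristicFunction.
Context (R : realType).
Implicit Types (z : R[i]) (x y : R).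

Definition nrm2 z : R := complex.Re z ^+ 2 + complex.Im z ^+ 2.

Lemma nrm2M z w : nrm2 (z * w) = nrm2 z * nrm2 w.
Proof. by case: z w => [a b] [c d]; rewrite /nrm2 /=; ring. Qed.

Lemma nrm2_ge0 z : 0 <= nrm2 z.
Proof. by rewrite addr_ge0 ?sqr_ge0. Qed.

Lemma cexpiD x y : cexpi (x + y) = cexpi x * cexpi y.
Proof. by rewrite /cexpi cosD sinD; congr Complex; rewrite addrC mulrC. Qed.

Lemma nrm2_cexpi x : nrm2 (cexpi x) = 1.
Proof. exact: cos2Dsin2. Qed.

Lemma cos2pi_int x (k : int) : cos (x + 2 * pi * k%:~R) = cos x.
Proof.
have cn (y : R) (n : nat) : cos (y + 2 * pi * n%:R) = cos y.
  by rewrite mulr_natl mulr_natr; exact: (periodicn (@cosD2pi R)).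
case: k => n; first exact: cn.
rewrite -(cn _ n.+1); congr cos.
by rewrite NegzE mulrNz mulrN subrK.
Qed.

Lemma sin2pi_int x (k : int) : sin (x + 2 * pi * k%:~R) = sin x.
Proof.
by rewrite -!cosBpihalf addrAC cos2pi_int.
Qed.

Definition mhat (s : seq int) x : R[i] :=
  Complex (avg s (fun b => cos (2 * pi * x * b%:~R)))
          (avg s (fun b => sin (2 * pi * x * b%:~R))).

Lemma mhat_int s x (k : int) : mhat s (x + k%:~R) = mhat s x.
Proof.
have e (b : int) : 2 * pi * (x + k%:~R) * b%:~R =
    2 * pi * x * b%:~R + 2 * pi * (k * b)%:~R by rewrite intrM; ring.
by congr Complex; apply: eq_avg => b; rewrite e ?cos2pi_int ?sin2pi_int.
Qed.

Lemma nrm2_mhat s x : nrm2 (mhat s x) =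
  (size s)%:R^-1 ^+ 2 *
  \sum_(b <- s) \sum_(c <- s) cos (2 * pi * x * (b - c)%:~R).
Proof.
rewrite /nrm2 /mhat /avg /= !exprMn -mulrDr; congr (_ * _).
rewrite !expr2 !mulr_suml -big_split /=; apply: eq_bigr => b _.
rewrite !mulr_sumr -big_split /=; apply: eq_bigr => c _.
by rewrite intrB mulrBr cosB.
Qed.

(** Unitarity makes distinct digits orthogonal over L. Expanding the squared modulus into pairs of
    digits and summing over L first leaves only the diagonal pairs, whatever x is. *)
Lemma admissible_parseval (N : int) (B : seq int) : admissible R N B ->
  exists L : seq int, 0 \in L /\ forall x,
    \sum_(l <- L) nrm2 (mhat B (x + l%:~R / N%:~R)) = 1.
Proof.
move=> [N1 [uB [B2 [L [uL [sL /matrixP HU]]]]]].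
have n0 : ((size B)%:R : R) != 0 by rewrite pnatr_eq0; case: (size B) B2.
(* Orthogonality of the rows of U, with the factor 1 / #B cleared. *)
have orth (i j : 'I_(size B)) :
    \sum_(k < size B) cexpi (- (2 * pi) *
       ((B`_i - B`_j)%:~R / N%:~R * (L`_k)%:~R) : R) =
    (real_complex R (size B)%:R) * (i == j)%:R.
  have := HU i j; rewrite !mxE => /(congr1 ( *%R (real_complex R (size B)%:R))) <-.
  rewrite mulr_sumr; apply: eq_bigr => k _; rewrite !mxE.
  set a := (X in cexpi X); set b := (X in _ * cexpi X); set c := (X in conjc (_ * cexpi X)).
  have -> : a = b - c by rewrite /a /b /c intrB; ring.
  set q := (Num.sqrt _)^-1.
  have q2 : (size B)%:R * q * q = 1.
    by rewrite -mulrA -expr2 /q exprVn sqr_sqrtr ?ler0n// mulfV.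
  rewrite /cexpi /real_complex_def cosB sinB; move: q2; move: ((size B)%:R : R) => r q2.
  apply/eqP; rewrite eq_complex /=; apply/andP; split; apply/eqP.
    transitivity ((r * q * q) * (cos b * cos c + sin b * sin c)); last by ring.
    by rewrite q2 mul1r.
  transitivity ((r * q * q) * (sin b * cos c - cos b * sin c)); last by ring.
  by rewrite q2 mul1r.
have pars x : \sum_(l <- L) nrm2 (mhat B (x + l%:~R / N%:~R)) = 1.
  under eq_bigr do rewrite nrm2_mhat.
  rewrite -mulr_sumr.
  suff -> : \sum_(l <- L) \sum_(b <- B) \sum_(c <- B)
      cos (2 * pi * (x + l%:~R / N%:~R) * (b - c)%:~R) = (size B)%:R ^+ 2.
    by rewrite -exprMn mulVf// expr1n.
  rewrite exchange_big /= (big_nth 0) big_mkord.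
  transitivity (\sum_(i < size B) (size B)%:R : R); last first.
    by rewrite sumr_const card_ord expr2 mulr_natr.
  apply: eq_bigr => i _; rewrite exchange_big /= (big_nth 0) big_mkord.
  transitivity (\sum_(j < size B) ((size B)%:R * (j == i)%:R) : R); last first.
    by rewrite -mulr_sumr -natr_sum (bigD1 i)//= eqxx big1 ?addn0 ?mulr1// => j /negbTE->.
  apply: eq_bigr => j _.
  (* The phase coming from x does not depend on the element of L and factors out, so the sum over L
     is a row relation. *)
  transitivity (complex.Re (cexpi (2 * pi * x * (B`_i - B`_j)%:~R) *
    \sum_(k < size B) cexpi (- (2 * pi) *
       ((B`_j - B`_i)%:~R / N%:~R * (L`_k)%:~R) : R))).
    rewrite mulr_sumr (big_morph (@complex.Re R) (id1 := 0) (op1 := +%R))//; last by case=> ? ? [].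
    rewrite (big_nth 0) big_mkord sL; apply: eq_bigr => k _.
    rewrite -cexpiD /=; congr cos; rewrite !intrB; ring.
  rewrite orth; case: (eqVneq j i) => [->|] /=; last by rewrite !mulr0 /= => _; ring.
  rewrite subrr mulr0 cos0 sin0 /real_complex_def /=; ring.
have : (0 < size L)%N by rewrite sL; case: (size B) B2.
case: L {uL sL HU orth} pars => // l0 L pars _.
(* Translating L puts 0 into it and merely shifts x, for which the identity is already known. *)
exists [seq l - l0 | l <- l0 :: L]; split; first by rewrite /= subrr mem_head.
move=> x; rewrite big_map -[RHS](pars (x - l0%:~R / N%:~R)).
by apply: eq_bigr => l _; congr (nrm2 (mhat _ _)); rewrite intrB; ring.
Qed.

End CharacteristicFunction.

(** * Transforms and nested spectra of the finite convolutions *)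

Section FiniteConvolution.
Context (R : realType) (N : nat -> int) (B : nat -> seq int).
Implicit Types x y : R.

Definition muhat (s m : nat) x : R[i] :=
  Complex (dexp N B s m (fun t => cos (2 * pi * x * t)))
          (dexp N B s m (fun t => sin (2 * pi * x * t))).

(** The first digit is independent of the tail, so the transforms multiply. *)
Lemma muhatS s m x : muhat s m.+1 x =
  mhat (B s) (x / (N s)%:~R) * muhat s.+1 m (x / (N s)%:~R).
Proof.
have e (b : int) y : 2 * pi * x * ((b%:~R + y) / (N s)%:~R) =
  2 * pi * (x / (N s)%:~R) * b%:~R + 2 * pi * (x / (N s)%:~R) * y by ring.
have comb (f g : int -> R) (c d : R) :
    avg (B s) (fun b => f b * c + g b * d) = avg (B s) f * c + avg (B s) g * d.
  rewrite -(eq_avg _ (fun b => congr2 +%R (mulrC c _) (mulrC d _))).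
  by rewrite avgD !avgZ ![_ * avg _ _]mulrC.
have dcomb (f g : R -> R) (c d : R) :
    dexp N B s.+1 m (fun y => c * f y + d * g y) =
    c * dexp N B s.+1 m f + d * dexp N B s.+1 m g.
  by rewrite dexpD !dexpZ.
apply/eqP; rewrite eq_complex /=; apply/andP; split; apply/eqP.
  rewrite -mulrN -comb; apply: eq_avg => b; rewrite mulrN -mulNr -dcomb.
  by apply: eq_dexp => y; rewrite e cosD mulNr.
rewrite addrC -comb; apply: eq_avg => b; rewrite -dcomb.
by apply: eq_dexp => y; rewrite e sinD.
Qed.

Lemma muhat0 s x : muhat s 0 x = 1.
Proof. by rewrite /muhat /= mulr0 cos0 sin0. Qed.

Lemma muhatD s m k x : muhat s (m + k) x =
  muhat s m x * muhat (s + m) k (x / (\prod_(s <= j < s + m) N j)%:~R).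
Proof.
elim: m s x => [|m IH] s x.
  by rewrite muhat0 mul1r addn0 big_geq// divr1.
rewrite addSn !muhatS IH mulrA addSnnS; congr (_ * muhat _ _ _).
by rewrite [in RHS]big_ltn ?addnS ?ltnS ?leq_addr// intrM invfM mulrA.
Qed.

Definition Pn (n : nat) : int := \prod_(j < n) N j.

Lemma PnS n : Pn n.+1 = Pn n * N n.
Proof. by rewrite /Pn big_ord_recr. Qed.

Lemma muhat_cat m k x : muhat 0 (m + k) x = muhat 0 m x * muhat m k (x / (Pn m)%:~R).
Proof. by rewrite muhatD add0n big_mkord. Qed.

Lemma muhat0S n x : muhat 0 n.+1 x = muhat 0 n x * mhat (B n) (x / (Pn n.+1)%:~R).
Proof.
rewrite -addn1 muhat_cat muhatS muhat0 mulr1 addn1 PnS intrM invfM.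
by rewrite mulrA.
Qed.

Hypothesis N_gt0 : forall n, 0 < N n.

Lemma Pn_gt0 n : 0 < Pn n.
Proof. by elim: n => [|n IH]; [rewrite /Pn big_ord0|rewrite PnS mulr_gt0]. Qed.

(** The law of the first n digits lives on the multiples of 1 / P_n, hence its transform has period
    P_n. *)
Lemma muhat_period n x (k : int) :
  muhat 0 n (x + (Pn n * k)%:~R) = muhat 0 n x.
Proof.
elim: n x k => [|n IH] x k; first by rewrite !muhat0.
rewrite !muhat0S PnS -mulrA IH mulrA mulrDl; congr (_ * _).
rewrite [X in _ + X / _]intrM mulrAC mulfV ?mul1r ?mhat_int//.
by rewrite intr_eq0 -PnS gt_eqF ?Pn_gt0.
Qed.

(** The representative of x modulo P in [-P / 2, P / 2): the quotient is the floor of x / P + 1 / 2,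
    written in integers. *)
Definition balmod (P x : int) : int := x - P * ((2 * x + P) %/ (2 * P))%Z.

Lemma balmodP (P x : int) : 0 < P -> - P <= 2 * balmod P x < P.
Proof.
move=> P0; have := divz_eq (2 * x + P) (2 * P).
have := modz_ge0 (2 * x + P) (d := 2 * P); have := ltz_pmod (2 * x + P) (d := 2 * P).
rewrite /balmod; move: (_ %/ _)%Z (_ %% _)%Z => q r; nia.
Qed.

Lemma balmod_id (P x : int) : - P <= 2 * x < P -> balmod P x = x.
Proof.
move=> H; rewrite /balmod divz_small ?mulr0 ?subr0//; lia.
Qed.

Variable L : nat -> seq int.
Hypothesis L0 : forall n, 0 \in L n.
Hypothesis Lpars : forall n x,
  \sum_(l <- L n) nrm2 (mhat (B n) (x + l%:~R / (N n)%:~R)) = 1.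

Fixpoint Lam (n : nat) : seq int :=
  if n is n'.+1 then [seq balmod (Pn n) (a + Pn n' * l) | a <- Lam n', l <- L n']
  else [:: 0].

Lemma Lam_bound n : {in Lam n, forall a : int, - Pn n <= 2 * a < Pn n}.
Proof.
case: n => [|n] x; first by rewrite inE /Pn big_ord0 => /eqP ->.
by move=> /allpairsP[[y l] [_ _ ->]]; exact/balmodP/Pn_gt0.
Qed.

(** The choice l = 0 reproduces x, since P_n <= P_(n+1) puts x already in the balanced range of the
    next level. *)
Lemma LamS n : {subset Lam n <= Lam n.+1}.
Proof.
move=> x xL; apply/allpairsP; exists (x, 0); split => //=.
rewrite mulr0 addr0 balmod_id//; have := Lam_bound xL.
rewrite PnS; have := N_gt0 n; have := Pn_gt0 n; nia.
Qed.

Lemma Lam_sub m n : (m <= n)%N -> {subset Lam m <= Lam n}.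
Proof.
move=> /subnKC <-; elim: (n - m)%N => [|k IH] x; first by rewrite addn0.
by move=> /IH xL; rewrite addnS; exact: LamS.
Qed.

(** Reduction modulo P_(n+1) does not change the transform of n + 1 digits, and adding P_n l does
    not change that of n digits. Hence the sum over l concerns the last factor only, and is 1 by
    [Lpars]. *)
Lemma Lam_parseval n x : \sum_(l <- Lam n) nrm2 (muhat 0 n (x + l%:~R)) = 1.
Proof.
elim: n x => [|n IH] x.
  by rewrite big_seq1 muhat0 /nrm2 /= expr1n expr0n addr0.
rewrite big_allpairs_dep -[RHS](IH x); apply: eq_bigr => y _.
rewrite -[RHS]mulr1 -[X in _ = _ * X](Lpars n ((x + y%:~R) / (Pn n.+1)%:~R)) mulr_sumr.
apply: eq_bigr => l _; rewrite -nrm2M; congr nrm2.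
rewrite /balmod; set q := (_ %/ _)%Z.
have -> : x + (y + Pn n * l - Pn n.+1 * q)%:~R =
    x + y%:~R + (Pn n * l)%:~R + (Pn n.+1 * - q)%:~R :> R.
  by rewrite mulrN rmorphB /= !intrD rmorphN /=; ring.
rewrite muhat_period muhat0S muhat_period; congr (_ * mhat _ _).
have Pn0 : (Pn n)%:~R != 0 :> R by rewrite intr_eq0 gt_eqF ?Pn_gt0.
have Nn0 : (N n)%:~R != 0 :> R by rewrite intr_eq0 gt_eqF.
by rewrite PnS !intrM; field; apply/andP; split.
Qed.

Hypothesis B0 : forall n, (0 < size (B n))%N.

Lemma muhat_at0 s m : muhat s m 0 = 1.
Proof.
rewrite /muhat mulr0.
rewrite (@eq_dexp _ _ _ _ _ _ (fun=> 1)) => [|y]; last by rewrite mul0r cos0.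
rewrite (@eq_dexp _ _ _ _ _ (fun t => sin _) (fun=> 0)) => [|y]; last by rewrite mul0r sin0.
by rewrite !dexp_cst.
Qed.

(** At the point - y the term l = y alone is already 1. Multiplicities are not yet controlled here,
    so exactly one occurrence of y is removed by [rem]. *)
Lemma Lam_nrm2_rem n (y : int) : y \in Lam n ->
  \sum_(l <- rem y (Lam n)) nrm2 (muhat 0 n (l - y)%:~R) = 0.
Proof.
move=> yL; have := Lam_parseval n (- y)%:~R.
rewrite (perm_big _ (perm_to_rem yL)) big_cons /= rmorphN addNr muhat_at0.
rewrite {1}/nrm2 /= expr1n expr0n addr0 => /eqP.
rewrite -[X in _ == X]addr0 (inj_eq (addrI _)) => /eqP S0.
rewrite -[RHS]S0; apply: eq_bigr => l _; by rewrite rmorphB /= addrC.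
Qed.

Lemma Lam_orth_rem n (y : int) : y \in Lam n ->
  {in rem y (Lam n), forall x : int, muhat 0 n (x - y)%:~R = 0}.
Proof.
move=> yL x xL; have := Lam_nrm2_rem yL.
rewrite (perm_big _ (perm_to_rem xL)) big_cons /= => /eqP.
rewrite paddr_eq0 ?nrm2_ge0//; last by apply: sumr_ge0 => ? _; exact: nrm2_ge0.
move=> /andP[+ _]; rewrite /nrm2 paddr_eq0 ?sqr_ge0// !sqrf_eq0.
by case: (muhat _ _ _) => a b /= /andP[/eqP -> /eqP ->].
Qed.

(** A second occurrence of y would contribute the value 1 at frequency 0, whereas [Lam_orth_rem]
    makes it vanish. *)
Lemma Lam_uniq n : uniq (Lam n).
Proof.
have H (y : int) : y \in Lam n -> y \notin rem y (Lam n).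
  move=> yL; apply/negP => /(Lam_orth_rem yL); rewrite subrr muhat_at0 => /eqP.
  by rewrite oner_eq0.
apply: count_mem_uniq => y; have [yL|/count_memPn->//] := boolP (y \in Lam n).
rewrite (permP (perm_to_rem yL)) /= eqxx.
by have /count_memPn -> := H _ yL.
Qed.

Lemma Lam_orth n : {in Lam n &, forall x y : int, x != y -> muhat 0 n (x - y)%:~R = 0}.
Proof.
move=> x y xL yL xy; apply: (Lam_orth_rem yL).
by rewrite mem_rem_uniq ?Lam_uniq// inE xy.
Qed.

End FiniteConvolution.

(** * Lower bounds from partial concentration *)

Lemma digit_bounds (n b : int) : 0 <= b < n ->
  [/\ b != 0 -> 1 <= b, b + 1 <= n & b != n - 1 -> b + 2 <= n].
Proof. by split; lia. Qed.

Section LowerBound.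
Context (R : realType) (N : nat -> int) (B : nat -> seq int).
Implicit Types x t u A : R.

Lemma ler_cos_abs t A : `|t| <= A -> A <= pi -> cos A <= cos t.
Proof.
move=> tA Api; have tpi := le_trans tA Api; have A0 := le_trans (normr_ge0 t) tA.
by rewrite -(cos_norm t) leNgt ltr_cos ?in_itv/= ?normr_ge0 ?tpi ?A0 ?Api// -leNgt.
Qed.

(** The expectation is the real part of exp (-2 pi i x t0) times the transform at x, hence at most
    its modulus. *)
Lemma dexp_cos_nrm2 s m x t0 c : 0 <= c ->
  c <= dexp N B s m (fun t => cos (2 * pi * x * (t - t0))) ->
  c ^+ 2 <= nrm2 (muhat N B s m x).
Proof.
move=> c0 cle; pose a := 2 * pi * x * t0.
have E : dexp N B s m (fun t => cos (2 * pi * x * (t - t0))) =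
    cos a * complex.Re (muhat N B s m x) + sin a * complex.Im (muhat N B s m x).
  rewrite /= -!dexpZ -dexpD; apply: eq_dexp => t.
  by rewrite mulrBr cosB [_ * cos a]mulrC [_ * sin a]mulrC.
rewrite E in cle; apply: (@le_trans _ _ ((cos a * complex.Re (muhat N B s m x) +
   sin a * complex.Im (muhat N B s m x)) ^+ 2)).
  by rewrite ler_pXn2r// nnegrE (le_trans c0).
rewrite /nrm2; move: (complex.Re _) (complex.Im _) => C S.
rewrite -[leRHS]mul1r -(cos2Dsin2 a) -subr_ge0.
rewrite [X in 0 <= X](_ : _ = (sin a * C - cos a * S) ^+ 2) ?sqr_ge0//.
by ring.
Qed.

Definition unit_itv t := (0 <= t) && (t <= 1).

Definition rem_ratio (j : nat) : R :=
  (rem_card (N j) (B j))%:R / (size (B j))%:R.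

Definition tail_rem s m : R := \sum_(s <= j < s + m) rem_ratio j.

Hypothesis N_ge2 : forall n, 2 <= N n.
Hypothesis B_ge2 : forall n, (2 <= size (B n))%N.
Hypothesis B_uniq : forall n, uniq (B n).

Let Nr n : 2 <= (N n)%:~R :> R.
Proof. by rewrite (ler_int _ 2). Qed.

Let B_gt0 n : (0 < size (B n))%N.
Proof. exact: ltnW. Qed.

Lemma unit_itv_digit s (b : int) t : 0 <= b < N s -> unit_itv t ->
  unit_itv ((b%:~R + t) / (N s)%:~R).
Proof.
move=> bs /andP[t0 t1]; have := Nr s => N2.
have b0 : 0 <= b%:~R :> R by rewrite ler0z; case/andP: bs.
have [_ bN _] := digit_bounds bs.
have {}bN : b%:~R + 1 <= (N s)%:~R :> R by rewrite -(intrD _ _ 1) ler_int.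
rewrite /unit_itv divr_ge0 ?ler_pdivrMr; lra.
Qed.

(** A union bound along the recursion: a digit in {0, ..., N_s - 1} maps a tail in [0, 1] back into
    [0, 1], so leaving [0, 1] requires at least one digit out of range. *)
Lemma dexp_out s m :
  dexp N B s m (fun t => (~~ unit_itv t)%:R) <= tail_rem s m.
Proof.
elim: m s => [|m IH] s.
  by rewrite /tail_rem /= addn0 big_geq// /unit_itv lexx ler01.
rewrite /tail_rem big_ltn ?addnS ?ltnS ?leq_addr//.
rewrite /rem_ratio /rem_card -avg_count.
apply: (@le_trans _ _ (avg (B s) (fun b => (~~ ((0 <= b) && (b < N s)))%:R +
   dexp N B s.+1 m (fun t => (~~ unit_itv t)%:R)))).
  apply: ler_avg => b _.
  rewrite -[X in _ <= X + _](@dexp_cst R N B B_gt0 s.+1 m) -dexpD.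
  apply: ler_dexp => t.
  case: (boolP (0 <= b < N s)) => bN; case: (boolP (unit_itv t)) => tI.
  - by rewrite unit_itv_digit// addr0.
  - by rewrite /= add0r; case: (unit_itv _); rewrite ?ler01.
  - by rewrite /= addr0; case: (unit_itv _); rewrite ?ler01.
  - by rewrite /=; case: (unit_itv _) => /=; lra.
rewrite avgD avg_cst// lerD2l.
by have := IH s.+1; rewrite /tail_rem addSn.
Qed.

Lemma dexp_unit_itv s m :
  1 - tail_rem s m <= dexp N B s m (fun t => (unit_itv t)%:R).
Proof.
rewrite lerBlDr -[leLHS](@dexp_cst R N B B_gt0 s m).
apply: (le_trans _ (lerD (lexx _) (dexp_out s m))).
rewrite -dexpD; apply: ler_dexp => t.
by case: (unit_itv t); rewrite /= ?addr0 ?add0r.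
Qed.

(** The good events [gb] of the digit and [gy] of the tail are independent, so both occur with
    probability at least c d, and then the gain is z. The loss g is uniform; [ob] and [oy] mark
    exceptional events, paid for by their probabilities. *)
Lemma dexp_cos_lower s m x t0 z c d p q g (gb ob : pred int) (gy oy : pred R) :
  0 <= z ->
  (forall b t, z * (gb b && gy t)%:R - g - (ob b)%:R - (oy t)%:R <=
     cos (2 * pi * x * ((b%:~R + t) / (N s)%:~R - t0))) ->
  0 <= c <= (count gb (B s))%:R / (size (B s))%:R ->
  0 <= d <= dexp N B s.+1 m (fun t => (gy t)%:R) ->
  (count ob (B s))%:R / (size (B s))%:R <= p ->
  dexp N B s.+1 m (fun t => (oy t)%:R) <= q ->
  z * (c * d) - g - p - q <=
    dexp N B s m.+1 (fun t => cos (2 * pi * x * (t - t0))).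
Proof.
move=> z0 H /andP[c0 cc] /andP[d0 dd] pp qq.
apply: (@le_trans _ _ (avg (B s) (fun b =>
    (z * dexp N B s.+1 m (fun t => (gy t)%:R)) * (gb b)%:R
    + (- 1) * (ob b)%:R + (- g - dexp N B s.+1 m (fun t => (oy t)%:R))))).
  rewrite !avgD !avgZ !avg_cst// !avg_count.
  have : z * (c * d) <= z * dexp N B s.+1 m (fun t => (gy t)%:R) *
      ((count gb (B s))%:R / (size (B s))%:R).
    rewrite -mulrA ler_wpM2l// mulrC ler_pM//.
  lra.
apply: ler_avg => b _.
set E := dexp _ _ _ _ (fun t => (oy t)%:R).
rewrite (_ : _ + _ = dexp N B s.+1 m (fun t => (gb b)%:R * (z * (gy t)%:R) +
    (-1) * (oy t)%:R + (- g - (ob b)%:R))); last first.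
  by rewrite !dexpD !dexpZ !dexp_cst// -/E; ring.
apply: ler_dexp => t; apply: le_trans (H b t).
by case: (gb b); case: (gy t); rewrite /= ?mul0r ?mul1r ?mulr0; lra.
Qed.

(* With [t0 = 1/2] the integrand is nonnegative on [0, 1] for [|x| <= 1/2], and
   positive on compact subsets of (0, 1): no integer translate of x is needed. *)
Lemma dexp_cos_interior (l c : R) : 0 < l < 1/2 -> 0 < c <= 1 ->
  exists e d h : R, [/\ 0 < e, 0 < d, 0 < h &
  forall s m x (gb : pred int) (gy : pred R) (c1 c2 : R),
    (forall b t, gb b -> gy t ->
       l <= (b%:~R + t) / (N s)%:~R <= 1 - l) ->
    0 <= c1 <= (count gb (B s))%:R / (size (B s))%:R ->
    0 <= c2 <= dexp N B s.+1 m (fun t => (gy t)%:R) ->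
    c <= c1 * c2 -> rem_ratio s <= h -> tail_rem s.+1 m <= h ->
    `|x| <= 1/2 + d ->
    e <= dexp N B s m.+1 (fun t => cos (2 * pi * x * (t - 1/2)))].
Proof.
move=> /andP[l0 l1] /andP[c0 c1].
have pi0 : 0 < pi :> R := pi_gt0 R.
(* The largest angle on the good event: |u - 1/2| <= 1/2 - l and d <= l / 2 give pi (1/2 + d) (1 - 2
   l) <= (pi / 2) (1 - l). *)
pose z := cos (pi / 2 * (1 - l)).
have z0 : 0 < z by rewrite /z; apply: cos_gt0_pihalf; nra.
(* Of the gain c z, g is given up everywhere and c z / 8 for each of the two exceptional events,
   which leaves e = c z / 2. *)
pose g := c * z / 4.
have z1 : z <= 1 by exact: cos_le1.
have g0 : 0 < g by rewrite /g; nra.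
have g1 : g < 1 by rewrite /g; nra.
pose A := acos (- g).
have Ai : -1 <= - g <= 1 by apply/andP; split; lra.
have cA : cos A = - g by apply: acosK; rewrite in_itv.
have A0 : 0 <= A by exact: acos_ge0.
have Api : A <= pi by exact: acos_lepi.
have AP : pi / 2 < A.
  rewrite -ltr_cos ?in_itv/= ?A0 ?Api//; last by apply/andP; split; lra.
  by rewrite cos_pihalf cA oppr_lt0.
(* For |x| slightly above 1/2 the angle on [0, 1] may exceed pi / 2; the second bound keeps it at
   most A, so the cosine stays at least - g. *)
pose d := Num.min (l / 2) ((A - pi / 2) / pi).
have d0 : 0 < d by rewrite lt_min !divr_gt0// subr_gt0.
have dl : d <= l / 2 by rewrite ge_min lexx.
have dA : pi * d <= A - pi / 2.
  by rewrite mulrC -ler_pdivlMr// ge_min lexx orbT.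
have h0 : 0 < c * z / 8 by nra.
exists (c * z / 2), d, (c * z / 8); split => //; first by nra.
move=> s m x gb gy c1' c2' Hg Hc1 Hc2 Hc rs ts xd.
have := @dexp_cos_lower s m x (1/2) z c1' c2' (c * z / 8) (c * z / 8) g gb
  (fun b => ~~ ((0 <= b) && (b < N s))) gy (fun t => ~~ unit_itv t) (ltW z0) _ Hc1 Hc2 rs
  (le_trans (dexp_out _ _) ts).
move=> H; apply: le_trans (H _) => {H}.
  rewrite /g; nra.
move=> b t; set u := (_ + _) / _.
have ang U : `|u - 1/2| <= U -> `|2 * pi * x * (u - 1/2)| <= 2 * pi * (1/2 + d) * U.
  move=> uU; rewrite normrM ler_pM// !normrM ger0_norm// (ger0_norm (ltW pi0)).
  by rewrite ler_pM2l// mulr_gt0.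
case: (boolP (gb b && gy t)) => [/andP[gbb gyt]|_] /=.
  have /andP[] := Hg b t gbb gyt; rewrite -/u => u1 u2.
  have : z <= cos (2 * pi * x * (u - 1 / 2)).
    apply: ler_cos_abs; last by nra.
    apply: (le_trans (ang (1/2 - l) _)); first by rewrite ler_norml; apply/andP; split; lra.
    have : (1 + 2 * d) * (1 - 2 * l) <= 1 - l by nra.
    nra.
  have := ler0n R (~~ (0 <= b < N s)); have := ler0n R (~~ unit_itv t).
  lra.
(* A digit in range and a tail in [0, 1] put u in [0, 1]; otherwise the trivial bound -1 is paid for
   by an exceptional event. *)
case: (boolP (0 <= b < N s)) => bN; case: (boolP (unit_itv t)) => tI /=.
- have /andP[] := unit_itv_digit bN tI; rewrite -/u => u1 u2.
  have : - g <= cos (2 * pi * x * (u - 1 / 2)).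
    rewrite -cA; apply: ler_cos_abs => //.
    apply: (le_trans (ang (1/2) _)); first by rewrite ler_norml; apply/andP; split; lra.
    nra.
  lra.
- by have := cos_geN1 (2 * pi * x * (u - 1 / 2)); lra.
- by have := cos_geN1 (2 * pi * x * (u - 1 / 2)); lra.
- by have := cos_geN1 (2 * pi * x * (u - 1 / 2)); lra.
Qed.

(** Among at least two distinct digits at most one equals p, so at least half of them differ from p;
    digits out of range are then discounted. *)
Lemma count_nonzero_digits s (p : int) :
  1 / 2 - rem_ratio s <=
  (count (fun b => (0 <= b < N s) && (b != p)) (B s))%:R / (size (B s))%:R.
Proof.
have n0 : 0 < (size (B s))%:R :> R by rewrite ltr0n.
rewrite lerBlDr /rem_ratio -mulrDl ler_pdivlMr// -natrD.
have : (size (B s) <= count (fun b => ((0 <= b < N s) && (b != p))%R) (B s) +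
    rem_card (N s) (B s) + 1)%N.
  have c1 : (count_mem p (B s) <= 1)%N by rewrite count_uniq_mem//; case: (_ \in _).
  apply: leq_trans (leq_add (leqnn _) c1).
  rewrite /rem_card; elim: (B s) => //= b t IH.
  by move: IH; case: (0 <= b < N s); case: (b == p) => /=; lia.
have := B_ge2 s; set k := (_ + rem_card _ _)%N => sz le.
have : (size (B s))%:R <= k%:R + 1 :> R by rewrite -(natrD _ k 1) ler_nat.
have : 2 <= (size (B s))%:R :> R by rewrite (ler_nat _ 2).
lra.
Qed.

(* Two distinct digits b already move mass of the digit tail away from 0 and 1. *)
Lemma dexp_cos_small_base (k : R) : 0 < k < 1/2 ->
  exists e d h : R, [/\ 0 < e, 0 < d, 0 < h &
  forall s m x, k < (N s)%:~R^-1 -> rem_ratio s <= h -> tail_rem s.+1 m <= h ->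
    `|x| <= 1/2 + d ->
    e <= dexp N B s m.+1 (fun t => cos (2 * pi * x * (t - 1/2)))].
Proof.
move=> /andP[k0 k1].
(* As k < 1 / N_s, staying half a digit away from both ends means staying k / 2 away. The constant
   1/16 is a digit probability 1/4 times a tail probability 1/4. *)
have [||e [d [h [e0 d0 h0 H]]]] := @dexp_cos_interior (k / 2) (1/16).
- by apply/andP; split; lra.
- by apply/andP; split; lra.
exists e, d, (Num.min h (1/4)); split => //; first by rewrite lt_min h0; lra.
move=> s m x kN; rewrite !le_min => /andP[rh r4] /andP[th t4] xd.
have N0 : 0 < (N s)%:~R :> R by have := Nr s; lra.
have i0 : (N s)%:~R * (N s)%:~R^-1 = 1 :> R by rewrite mulfV// gt_eqF.
have mass : 3/4 <= dexp N B s.+1 m (fun t => ((0 <= t) && (t <= 1/2))%:R) +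
   dexp N B s.+1 m (fun t => ((1/2 <= t) && (t <= 1))%:R).
  apply: (@le_trans _ _ (1 - tail_rem s.+1 m)); first by lra.
  apply: (le_trans (dexp_unit_itv s.+1 m)).
  rewrite -dexpD; apply: ler_dexp => t; rewrite /unit_itv.
  case: (boolP (_ && _)) => [/andP[t0 t1]|_]; last by rewrite addr_ge0 ?ler0n.
  have [t2|t2] := leP t (1/2); first by rewrite t0 /= lerDl ler0n.
  by rewrite (ltW t2) t1 /= lerDr ler0n.
have kN1 : k * (N s)%:~R <= 1 by rewrite -ler_pdivlMr// div1r ltW.
(* One half of [0, 1] carries tail mass at least 1/4. For the lower half the digit 0 is excluded, as
   it could bring the sum near 0; for the upper half the digit N_s - 1, which could bring it near
   1. *)
have [D1|D2] := leP (1/4) (dexp N B s.+1 m (fun t => ((0 <= t) && (t <= 1/2))%:R)).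
  apply: (H s m x (fun b => (0 <= b < N s) && (b != 0)) (fun t => (0 <= t) && (t <= 1/2)) (1/4) (1/4)) => //.
  - move=> b t /andP[/digit_bounds[b0 bN _] /b0 b1] /andP[t0 t1].
    have {}b1 : 1 <= b%:~R :> R by rewrite ler1z.
    have {}bN : b%:~R + 1 <= (N s)%:~R :> R by rewrite -(intrD _ _ 1) ler_int.
    by rewrite ler_pdivlMr// ler_pdivrMr//; apply/andP; split; lra.
  - by have := count_nonzero_digits s 0; lra.
  - by rewrite D1; lra.
  - by lra.
apply: (H s m x (fun b => (0 <= b < N s) && (b != N s - 1)) (fun t => (1/2 <= t) && (t <= 1)) (1/4) (1/4)) => //.
- move=> b t /andP[bs bN] /andP[t0 t1].
  have b1 : 0 <= b%:~R :> R by rewrite ler0z; case/andP: bs.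
  have [_ _ /(_ bN) {}bN] := digit_bounds bs.
  have {}bN : b%:~R + 2 <= (N s)%:~R :> R by rewrite -(intrD _ _ 2) ler_int.
  by rewrite ler_pdivlMr// ler_pdivrMr//; apply/andP; split; lra.
- by have := count_nonzero_digits s (N s - 1); lra.
- by apply/andP; split; lra.
- by lra.
Qed.

(** The tail shifts b / N_s by at most 1 / N_s <= l / 4, so digits in the middle range keep the sum
    in [l / 4, 1 - l / 4]; the tail lies in [0, 1] with probability at least 1/2. *)
Lemma dexp_cos_pcc_interior (l c : R) : 0 < l < 1 -> 0 < c <= 1 ->
  exists e d h : R, [/\ 0 < e, 0 < d, 0 < h &
  forall s m x d1 d2, (N s)%:~R^-1 <= l / 4 ->
    l / 2 * (N s)%:~R <= d1 -> d2 <= (1 - l / 2) * (N s)%:~R ->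
    c <= (count (fun b : int => (d1 <= b%:~R) && (b%:~R <= d2)) (B s))%:R
         / (size (B s))%:R ->
    rem_ratio s <= h -> tail_rem s.+1 m <= h -> `|x| <= 1/2 + d ->
    e <= dexp N B s m.+1 (fun t => cos (2 * pi * x * (t - 1/2)))].
Proof.
move=> /andP[l0 l1] /andP[c0 c1].
have [||e [d [h [e0 d0 h0 H]]]] := @dexp_cos_interior (l / 4) (c / 2).
- by apply/andP; split; lra.
- by apply/andP; split; lra.
exists e, d, (Num.min h (1/2)); split => //; first by rewrite lt_min h0; lra.
move=> s m x d1 d2 Nl dl1 dl2 cB; rewrite !le_min => /andP[rh r4] /andP[th t4] xd.
have N0 : 0 < (N s)%:~R :> R by have := Nr s; lra.
have i0 : (N s)%:~R * (N s)%:~R^-1 = 1 :> R by rewrite mulfV// gt_eqF.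
have lN : 1 <= l / 4 * (N s)%:~R by rewrite -ler_pdivrMr// div1r.
apply: (H s m x (fun b => (d1 <= b%:~R) && (b%:~R <= d2)) unit_itv c (1/2)) => //.
- move=> b t /andP[b1 b2] /andP[t0 t1].
  by rewrite ler_pdivlMr// ler_pdivrMr//; apply/andP; split; lra.
- by rewrite cB ltW.
- by have := dexp_unit_itv s.+1 m; lra.
- by lra.
Qed.

(** The centre is that of [d1, d2 + 1] / N_s, where the sum lies when the digit is in [d1, d2] and
    the tail in [0, 1]. The half-length is at most (1 + l) / 4 because 1 / N_s <= (1 - l) / 2. *)
Lemma dexp_cos_pcc_concentrated (l : R) : 0 < l < 1 ->
  exists e d h : R, [/\ 0 < e, 0 < d, 0 < h &
  forall s m x d1 d2, (N s)%:~R^-1 <= (1 - l) / 2 ->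
    0 < (d2 - d1) / (N s)%:~R < l ->
    (count (fun b : int => ~~ ((d1 <= b%:~R) && (b%:~R <= d2))) (B s))%:R
         / (size (B s))%:R <= h ->
    tail_rem s.+1 m <= h -> `|x| <= 1/2 + d ->
    e <= dexp N B s m.+1
      (fun t => cos (2 * pi * x * (t - (d1 + d2 + 1) / (2 * (N s)%:~R))))].
Proof.
move=> /andP[l0 l1].
have pi0 : 0 < pi :> R := pi_gt0 R.
(* With d = (1 - l) / 8 the largest angle 2 pi (1/2 + d) (1 + l) / 4 equals (pi / 2) th, and th < 1
   because l < 1. *)
pose th := (5 - l) * (1 + l) / 8.
have th0 : 0 < th by rewrite /th; nra.
have th1 : th < 1 by rewrite /th; nra.
pose z := cos (pi / 2 * th).
have z0 : 0 < z by rewrite /z; apply: cos_gt0_pihalf; nra.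
have z1 : z <= 1 by exact: cos_le1.
exists (z / 4), ((1 - l) / 8), (z / 16); split; try by lra.
move=> s m x d1 d2 Nl dl ob ts xd.
have N0 : 0 < (N s)%:~R :> R by have := Nr s; lra.
have i0 : (N s)%:~R * (N s)%:~R^-1 = 1 :> R by rewrite mulfV// gt_eqF.
move: dl => /andP[_]; rewrite ltr_pdivrMr// => dl.
have lN : 1 <= (1 - l) / 2 * (N s)%:~R by rewrite -ler_pdivrMr// div1r.
set gb := fun b : int => (d1 <= b%:~R) && (b%:~R <= d2).
have cgb : 1 - z / 16 <= (count gb (B s))%:R / (size (B s))%:R.
  have := count_predC gb (B s) => /(congr1 (fun k => k%:R : R)).
  rewrite natrD => cE.
  have n0 : 0 < (size (B s))%:R :> R by rewrite ltr0n.
  have : (count gb (B s))%:R / (size (B s))%:R + (count (predC gb) (B s))%:R / (size (B s))%:R = 1 :> R.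
    by rewrite -mulrDl cE mulfV// gt_eqF.
  by move: ob; rewrite -/gb; set q1 := _ / _; set q2 := (count gb _)%:R / _; set q3 := _ / _ => ? ?; lra.
have dgy := dexp_unit_itv s.+1 m.
have := @dexp_cos_lower s m x ((d1 + d2 + 1) / (2 * (N s)%:~R)) z (1 - z / 16) (1 - z / 16)
  (z / 16) (z / 16) 0 gb (fun b => ~~ gb b) unit_itv (fun t => ~~ unit_itv t)
  (ltW z0) _ _ _ ob (le_trans (dexp_out _ _) ts).
move=> H; apply: le_trans (H _ _ _) => {H}.
- nra.
- move=> b t; set u := _ / _ - _.
  case: (boolP (gb b)) => [/andP[b1 b2]|_]; case: (boolP (unit_itv t)) => [/andP[t0 t1]|_] /=; last first.
  + by have := cos_geN1 (2 * pi * x * u); lra.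
  + by have := cos_geN1 (2 * pi * x * u); lra.
  + by have := cos_geN1 (2 * pi * x * u); lra.
  rewrite mulr1 !subr0; apply: ler_cos_abs; last by nra.
  have uE : u = ((b%:~R - d1) + (b%:~R - d2) + (2 * t - 1)) / 2 * (N s)%:~R^-1.
    by rewrite /u; field; rewrite gt_eqF.
  have uU : `|u| <= (1 + l) / 4.
    rewrite uE normrM normfV (gtr0_norm N0) ler_pdivrMr// ler_norml.
    by apply/andP; split; lra.
  apply: (@le_trans _ _ (2 * pi * (1/2 + (1 - l) / 8) * ((1 + l) / 4))).
    rewrite normrM ler_pM// !normrM ger0_norm// (ger0_norm (ltW pi0)).
    by rewrite ler_pM2l// mulr_gt0.
  rewrite /th; nra.
- by apply/andP; split => //; lra.
- by apply/andP; split; lra.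
Qed.

Hypothesis rem_cvg : cvg (series rem_ratio @ \oo).

Lemma tail_rem_small h : 0 < h -> exists M, forall s m, (M <= s)%N -> tail_rem s m <= h.
Proof.
move=> h0; have /cauchy_cvgP/cauchy_seriesP/(_ h h0) := rem_cvg.
move=> [[P Q] /= [[M1 _ HP] [M2 _ HQ]] H].
exists (maxn M1 M2) => s m; rewrite geq_max => /andP[s1 s2].
have := H (s, (s + m)%N) => /= /(_ _)/ltW.
move=> H'; apply: le_trans (ler_norm _) (H' _); split; [exact: HP|apply: HQ].
by rewrite /= (leq_trans s2)// leq_addr.
Qed.

Lemma tail_rem1 s : tail_rem s 1 = rem_ratio s.
Proof. by rewrite /tail_rem addn1 big_nat1. Qed.

(** For a constant k depending on l, either infinitely many bases are below 1 / k, where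
    [dexp_cos_small_base] applies, or eventually 1 / N_s <= k, and the tail contributes too little
    to spoil the concentration of the digit. *)
Lemma muhat_lower (nk : nat -> nat) : (forall k, (nk k < nk k.+1)%N) ->
  PCC R (fun k => N (nk k)) (fun k => B (nk k)) ->
  exists e d : R, [/\ 0 < e, 0 < d & forall M, exists2 s, (M <= s)%N &
    forall m x, `|x| <= 1/2 + d -> e <= nrm2 (muhat N B s m x)].
Proof.
move=> nk_lt; have nk_ge k : (k <= nk k)%N.
  by elim: k => // k IH; rewrite (leq_ltn_trans IH).
(* A bound on the expectation for infinitely many s suffices; the minimum with 1 covers the empty
   tail, whose transform is 1. *)
have fin (e d h : R) (P : nat -> Prop) (t0 : nat -> R) : 0 < e -> 0 < d -> 0 < h ->
    (forall M, exists2 s, (M <= s)%N & P s) ->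
    (forall s m x, P s -> rem_ratio s <= h -> tail_rem s.+1 m <= h -> `|x| <= 1/2 + d ->
      e <= dexp N B s m.+1 (fun t => cos (2 * pi * x * (t - t0 s)))) ->
    exists e d : R, [/\ 0 < e, 0 < d & forall M, exists2 s, (M <= s)%N &
    forall m x, `|x| <= 1/2 + d -> e <= nrm2 (muhat N B s m x)].
  move=> e0 d0 h0 infP H; exists (Num.min 1 (e ^+ 2)), d; split => //.
    by rewrite lt_min ltr01 exprn_gt0.
  move=> M; have [M1 HM1] := tail_rem_small h0.
  have [s + Ps] := infP (maxn M M1); rewrite geq_max => /andP[Ms M1s].
  exists s => // -[|m] x xd.
    by rewrite muhat0 /nrm2 /= expr1n expr0n addr0 ge_min lexx.
  rewrite ge_min; apply/orP; right; apply: (@dexp_cos_nrm2 s _ x (t0 s)); first exact: ltW.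
  by apply: H => //; [rewrite -tail_rem1 HM1|rewrite HM1// ltnW].
move=> [l [l01 PC]].
have [l0 l1] := andP l01.
pose k := Num.min (l / 4) ((1 - l) / 2).
have k0 : 0 < k by rewrite lt_min; apply/andP; split; lra.
have kl : k <= l / 4 by rewrite ge_min lexx.
have kl' : k <= (1 - l) / 2 by rewrite ge_min lexx orbT.
have [inf|/existsNP[M HM]] := pselect (forall M, exists2 s, (M <= s)%N & k < (N s)%:~R^-1).
  have [|e [d [h [e0 d0 h0 H]]]] := @dexp_cos_small_base k; first by apply/andP; split; lra.
  by apply: (fin e d h (fun s => k < (N s)%:~R^-1) (fun=> 1/2)) => // s m x; exact: H.
have Nk s : (M <= s)%N -> (N s)%:~R^-1 <= k.
  by move=> Ms; rewrite leNgt; apply/negP => ks; apply: HM; exists s.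
case: PC => [[d1 [d2 [Hd cvd]]]|[c [c01 [d1 [d2 Hd]]]]].
  have [e [d [h [e0 d0 h0 H]]]] := @dexp_cos_pcc_concentrated l l01.
  pose P s := exists i, [/\ s = nk i, (M <= s)%N &
    (count (fun b : int => ~~ ((d1 i <= b%:~R) && (b%:~R <= d2 i))) (B s))%:R
         / (size (B s))%:R <= h].
  (* The centre depends on an index i with s = n_i, so one is chosen for each s, with 0 as a dummy
     elsewhere. *)
  have chP : forall s, exists t : R, P s -> forall m x, rem_ratio s <= h -> tail_rem s.+1 m <= h ->
       `|x| <= 1/2 + d -> e <= dexp N B s m.+1 (fun t' => cos (2 * pi * x * (t' - t))).
    move=> s; have [[i [si Ms Hi]]|nP] := pselect (P s); last by exists 0.
    exists ((d1 i + d2 i + 1) / (2 * (N s)%:~R)) => _ m x _ ts xd.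
    have [_ [_ dd]] := Hd i.
    by apply: H => //; [rewrite (le_trans (Nk _ Ms))|rewrite si].
  have [t0 Ht0] := choice chP.
  apply: (fin e d h P t0) => //; last by move=> s m x /Ht0; exact.
  (* Summability makes the fraction of digits outside the interval tend to 0. *)
  move=> M'; have /cvgrPdist_lt /(_ h h0) [K _ HK] := cvg_series_cvg_0 cvd.
  pose i := maxn K (maxn M M').
  exists (nk i); first by rewrite (leq_trans _ (nk_ge i))// !leq_max leqnn !orbT.
  exists i; split => //; first by rewrite (leq_trans _ (nk_ge i))// !leq_max leqnn !orbT.
  have := HK i; rewrite /= leq_maxl => /(_ isT) /ltW; rewrite sub0r normrN.
  by apply: le_trans; exact: ler_norm.
have [e [d [h [e0 d0 h0 H]]]] := @dexp_cos_pcc_interior l c l01 c01.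
apply: (fin e d h (fun s => (M <= s)%N /\ exists i, s = nk i) (fun=> 1/2)) => //.
  move=> M'; exists (nk (maxn M M')).
    by rewrite (leq_trans _ (nk_ge _))// leq_maxr.
  split; last by exists (maxn M M').
  by rewrite (leq_trans _ (nk_ge _))// leq_maxl.
move=> s m x [Ms [i si]] rh th xd.
have [/andP[h1 _] [/andP[_ h2] h3]] := Hd i.
apply: (H s m x (d1 i) (d2 i)) => //; try by rewrite si.
by rewrite (le_trans (Nk _ Ms)).
Qed.

End LowerBound.

(** * Existence of the infinite convolution *)

(** Pairs are listed row by row, so the quotient and remainder of an index by the length of the
    second list act as mixed-radix digits. *)
Lemma nth_allpairs (T1 T2 T3 : Type) (f : T1 -> T2 -> T3) (s : seq T1) (t : seq T2)
    (x : T1) (y : T2) (z : T3) (i : nat) : (i < size s * size t)%N ->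
  nth z [seq f a b | a <- s, b <- t] i =
  f (nth x s (i %/ size t)) (nth y t (i %% size t)).
Proof.
elim: s i => [|a s IH] i //=; rewrite mulSn => ist.
have t0 : (0 < size t)%N by case: (size t) ist => //; rewrite muln0.
rewrite nth_cat size_map; case: ltnP => it.
  by rewrite divn_small// modn_small// (nth_map y).
rewrite IH; last by rewrite ltn_subLR.
have ie : i = (1 * size t + (i - size t))%N by rewrite mul1n subnKC.
have -> : (i %/ size t)%N = ((i - size t) %/ size t).+1.
  by rewrite {1}ie divnMDl// add1n.
by have -> : (i %% size t)%N = ((i - size t) %% size t)%N by rewrite {1}ie modnMDl.
Qed.

Section Existence.
Context (R : realType) (N : nat -> int) (B : nat -> seq int).
Hypothesis N_ge2 : forall n, 2 <= N n.
Hypothesis B_gt0 : forall n, (0 < size (B n))%N.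
Hypothesis rem_cvg : cvg (series (rem_ratio R N B) @ \oo).

Let Om := measurableTypeR R.

Let U : probability Om R := uniform_prob (@ltr01 R).

Let U_itv (a b : R) : 0 <= a -> a <= b -> b <= 1 -> U `[a, b[%classic = (b - a)%:E.
Proof.
move=> a0 ab b1; rewrite /U /= /uniform_prob.
rewrite (eq_integral (cst 1%E)) => [|x]; last first.
  rewrite inE /= in_itv /= => /andP[ax xb]; rewrite /uniform_pdf.
  by rewrite (le_trans a0 ax) (ltW (lt_le_trans xb b1)) /= subr0 invr1.
rewrite integral_cst//= mul1e lebesgue_measure_itv /= lte_fin.
by case: ltP => // ba; rewrite (@le_anti _ _ a b) ?subrr// ab ba.
Qed.

Let M (n : nat) : nat := size (conv_atoms R N B n).

Let MS n : M n.+1 = (M n * size (B n))%N.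
Proof. by rewrite /M /= size_allpairs. Qed.

Let M_gt0 n : (0 < M n)%N.
Proof. by elim: n => // n IH; rewrite MS muln_gt0 IH B_gt0. Qed.

Let MR_gt0 n : 0 < (M n)%:R :> R.
Proof. by rewrite ltr0n. Qed.

(** Half-open cells of length 1 / M_n; [cell n i] carries the atom of index i, and its subcells at
    the next level correspond to the digits in [B n]. *)
Let cell (n i : nat) : set Om := `[i%:R / (M n)%:R, i.+1%:R / (M n)%:R[%classic.

Let cellE n i (t : R) : cell n i t = (i%:R <= t * (M n)%:R < i.+1%:R) :> Prop.
Proof. by rewrite /cell /= in_itv /= ler_pdivrMr// ltr_pdivlMr. Qed.

Let measurable_cell n i : measurable (cell n i).
Proof. exact: measurable_itv. Qed.

Let U_cell n i : (i < M n)%N -> U (cell n i) = ((M n)%:R^-1)%:E.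
Proof.
move=> iM; rewrite U_itv.
- by rewrite -mulrBl -natrB// subSnn mul1r.
- by rewrite divr_ge0.
- by rewrite ler_pM2r ?invr_gt0// ler_nat.
- by rewrite ler_pdivrMr// mul1r ler_nat.
Qed.

Let cell_uniq n i j (t : R) : cell n i t -> cell n j t -> i = j.
Proof.
rewrite !cellE => /andP[i1 i2] /andP[j1 j2]; apply/eqP; rewrite eqn_leq.
by rewrite -(ltnS i j) -(ltnS j i) -!(ltr_nat R) (le_lt_trans i1 j2) (le_lt_trans j1 i2).
Qed.

Let cell_cover n (t : R) : 0 <= t < 1 -> exists2 i, (i < M n)%N & cell n i t.
Proof.
move=> /andP[t0 t1]; have tM0 : 0 <= t * (M n)%:R by rewrite mulr_ge0.
exists (Num.truncn (t * (M n)%:R)); last by rewrite cellE truncn_itv.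
by rewrite truncn_lt_nat// gtr_pMl.
Qed.

Let cell_refine n i (t : R) : cell n.+1 i t -> cell n (i %/ size (B n)) t.
Proof.
have m0 : 0 < (size (B n))%:R :> R by rewrite ltr0n.
rewrite !cellE MS natrM mulrA => /andP[i1 i2]; apply/andP; split.
  rewrite -(ler_pM2r m0) (le_trans _ i1)// -natrM ler_nat leq_trunc_div//.
rewrite -(ltr_pM2r m0) (lt_le_trans i2)// -natrM ler_nat.
by rewrite ltn_ceil.
Qed.

Let digit n i : int := nth 0 (B n) (i %% size (B n)).

Let bad_digit n i : bool := ~~ ((0 <= digit n i) && (digit n i < N n)).

Let bad n : set Om :=
  \big[setU/set0]_(i < M n.+1) (if bad_digit n i then cell n.+1 i else set0).

Let measurable_bad n : measurable (bad n).
Proof. by apply: bigsetU_measurable => i _; case: ifP. Qed.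

Let U_bad n : (U (bad n) <= (rem_ratio R N B n)%:E)%E.
Proof.
apply: le_trans (@Boole_inequality _ _ _ U
  (fun i => if bad_digit n i then cell n.+1 i else set0) _ _) _.
  by move=> i _; case: ifP.
rewrite [leLHS](_ : _ = (\sum_(i < M n.+1)
    (bad_digit n i)%:R * (M n.+1)%:R^-1)%:E); last first.
  rewrite -sumEFin; apply: eq_bigr => i _; case: ifP => _; last by rewrite measure0 mul0r.
  by rewrite mul1r; exact: U_cell.
rewrite lee_fin -mulr_suml.
(* Along the cells of level n + 1 each entry of [B n] occurs M_n times, so the fraction of bad cells
   is the fraction of bad digits. *)
pose D := [seq b | x <- conv_atoms R N B n, b <- B n].
have sD : size D = M n.+1 by rewrite size_allpairs MS.
rewrite [X in X * _](_ : _ = \sum_(b <- D) (~~ ((0 <= b) && (b < N n)))%:R); last first.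
  rewrite (big_nth 0) big_mkord sD; apply: eq_bigr => i _.
  rewrite /bad_digit /digit (@nth_allpairs _ _ _ (fun=> id) _ _ 0 0)//.
  by rewrite -MS.
rewrite big_allpairs_dep /= big_const_seq count_predT iter_addr_0 -/(M n).
rewrite MS natrM -mulr_natr.
have -> : \sum_(b <- B n) (~~ ((0 <= b) && (b < N n)))%:R =
   (rem_card (N n) (B n))%:R :> R.
  by rewrite /rem_card -sum1_count natr_sum [in RHS]big_mkcond; apply: eq_bigr => b _; case: ifP.
rewrite /rem_ratio.
have m0 : (size (B n))%:R != 0 :> R by rewrite pnatr_eq0 -lt0n.
have M0 : (M n)%:R != 0 :> R by rewrite pnatr_eq0 -lt0n.
rewrite le_eqVlt; apply/orP; left; apply/eqP; field; apply/andP; split => //.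
Qed.

Let Xn (n : nat) (t : Om) : R :=
  \sum_(i < M n) nth 0 (conv_atoms R N B n) i * \1_(cell n i) t.

Let measurable_Xn n : measurable_fun setT (Xn n).
Proof.
by apply: measurable_sum => i; apply: measurable_funM.
Qed.

Let cell_sum n i (t : R) (g : nat -> R) : (i < M n)%N -> cell n i t ->
  \sum_(j < M n) g j * \1_(cell n j) t = g i.
Proof.
move=> iM it; rewrite (bigD1 (Ordinal iM))//= indicE mem_set// mulr1.
rewrite big1 ?addr0// => j ji; rewrite indicE memNset ?mulr0// => jt.
by move: ji; rewrite -val_eqE /= (cell_uniq jt it) eqxx.
Qed.

Let Xn_step n i (t : R) : (i < M n.+1)%N -> cell n.+1 i t ->
  Xn n.+1 t = Xn n t + (digit n i)%:~R / (cumN N n)%:~R.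
Proof.
move=> iM it; rewrite /Xn (cell_sum (nth 0 _) iM it).
rewrite (cell_sum (nth 0 _) _ (cell_refine it)); last first.
  by rewrite ltn_divLR// -MS.
by rewrite /= (@nth_allpairs _ _ _ _ _ _ 0 0)// -MS.
Qed.

Let N_gt0 n : 0 < N n.
Proof. exact: lt_le_trans (N_ge2 n). Qed.

Let P_gt0 n : 0 < (Pn N n)%:~R :> R.
Proof. by rewrite ltr0z Pn_gt0. Qed.

(** The intervals [X_n, X_n + 1 / P_n] are nested: the digit b satisfies 0 <= b and b + 1 <= N_n,
    and N_n / P_(n+1) = 1 / P_n. *)
Let Xn_good_step n (t : R) : 0 <= t < 1 -> ~ bad n t ->
  Xn n t <= Xn n.+1 t /\
  Xn n.+1 t + (Pn N n.+1)%:~R^-1 <= Xn n t + (Pn N n)%:~R^-1.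
Proof.
move=> t01 nbad; have [i iM it] := cell_cover n.+1 t01.
have : ~~ bad_digit n i.
  apply/negP => bi; apply: nbad; rewrite /bad -(bigcup_mkord _ (fun i => if bad_digit n i then cell n.+1 i else set0)) /=.
  by exists i => //=; rewrite bi.
rewrite negbK => /digit_bounds[d0 d1 _] => //.
have dig0 : 0 <= digit n i.
  by have := d1; move: d0; case: (eqVneq (digit n i) 0) => [->//|_] /(_ isT) /(le_trans ler01).
rewrite (Xn_step iM it) (_ : cumN N n = Pn N n.+1)//; split.
  by rewrite lerDl divr_ge0 ?ler0z// -(ler0z R) (ltW (P_gt0 _)).
rewrite -addrA lerD2l -[X in _ + X <= _]mul1r -mulrDl ler_pdivrMr ?P_gt0//.
by rewrite PnS intrM mulKf ?gt_eqF ?P_gt0// -(intrD _ _ 1) ler_int.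
Qed.

Let good : set Om := `[0, 1[%classic `\` lim_sup_set bad.

Let measurable_limsup : measurable (lim_sup_set bad).
Proof.
by apply: bigcap_measurable => // k _; exact: bigcup_measurable.
Qed.

Let measurable_good : measurable good.
Proof. exact: measurableD. Qed.

(** Borel-Cantelli: the probabilities of the bad events are dominated by the convergent remainder
    series. *)
Let U_limsup : U (lim_sup_set bad) = 0%E.
Proof.
apply: lim_sup_set_cvg0 => //.
apply: (@le_lt_trans _ _ (\sum_(n <oo) (rem_ratio R N B n)%:E)%E).
  by apply: lee_nneseries => // n _; exact: U_bad.
have : (fun n => (\sum_(0 <= k < n) (rem_ratio R N B k)%:E)%E) =
    EFin \o series (rem_ratio R N B).
  by apply/funext => n /=; rewrite sumEFin.
move=> ->; rewrite EFin_lim// ltry//.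
Qed.

Let U_good : U good = 1%E.
Proof.
have e : U (~` good) = 0%E.
  apply/eqP; rewrite eq_le measure_ge0 andbT.
  have sub : ~` good `<=` ~` `[0, 1[%classic `|` lim_sup_set bad.
    move=> t; rewrite /good => nt; have [lt|lt] := pselect (lim_sup_set bad t); first by right.
    by left => t01; apply: nt.
  apply: le_trans (le_measure U _ _ sub) _; rewrite ?inE//.
  - exact: measurableC.
  - by apply: measurableU => //; exact: measurableC.
  apply: le_trans (measureU2 _ _ _) _ => //; first exact: measurableC.
  have c0 : U (~` `[0, 1[%classic) = 0%E.
    by rewrite (probability_setC U (measurable_itv _)) U_itv ?ler01// subr0 subee.
  by rewrite [X in (X + _)%E]c0 [X in (_ + X)%E]U_limsup adde0.
by have := probability_setC U measurable_good; rewrite e; move/eqP; rewrite eq_sym sube_eq// ?add0e// => /eqP <-.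
Qed.

Let ae_good : {ae U, forall t, good t}.
Proof.
exists (~` good); split => //; first exact: measurableC.
by rewrite probability_setC// U_good subee.
Qed.

Let Xn_cvg (t : R) : good t -> cvgn (Xn ^~ t).
Proof.
move=> [t01 nlim]; rewrite /= in_itv /= in t01.
have [n0 Hn0] : exists n0, forall k, (n0 <= k)%N -> ~ bad k t.
  apply: contrapT => H; apply: nlim => n _; apply: contrapT => Hn; apply: H.
  by exists n => k nk bk; apply: Hn; exists k.
suff /cvg_ex[l] : cvgn (fun k => Xn (k + n0) t).
  by rewrite (cvg_shiftn n0 (Xn ^~ t)) => Hl; apply/cvg_ex; exists l.
apply: nondecreasing_is_cvgn.
  apply/nondecreasing_seqP => k; rewrite addSn.
  by have [] := Xn_good_step t01 (Hn0 (k + n0)%N (leq_addl _ _)).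
(* The upper endpoints X_k + 1 / P_k do not increase from n0 on, so the first of them bounds all
   later X_k. *)
exists (Xn n0 t + (Pn N n0)%:~R^-1) => _ [k _ <-] /=.
apply: (@le_trans _ _ (Xn (k + n0) t + (Pn N (k + n0))%:~R^-1)).
  by rewrite lerDl invr_ge0 ltW.
elim: k => // k IH; rewrite addSn; apply: le_trans IH.
by have [] := Xn_good_step t01 (Hn0 (k + n0)%N (leq_addl _ _)).
Qed.

(** Cutting off outside the good set makes the sequence converge at every point, so that its limit
    is measurable. *)
Let Xg (n : nat) (t : Om) : R := Xn n t * \1_good t.

Let X (t : Om) : R := limn (Xg ^~ t).

Let Xg_cvg t : Xg ^~ t @ \oo --> X t.
Proof.
suff : cvgn (Xg ^~ t) by [].
rewrite /Xg indicE; have [tg|tg] := pselect (good t).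
  rewrite mem_set//; under eq_fun do rewrite mulr1; exact: Xn_cvg.
by rewrite memNset//; under eq_fun do rewrite mulr0; exact: is_cvg_cst.
Qed.

Let Xn_cvgX (t : Om) : good t -> Xn ^~ t @ \oo --> X t.
Proof.
move=> tg; have := @Xg_cvg t; rewrite (_ : Xg ^~ t = Xn ^~ t)//; apply/funext => n.
by rewrite /Xg indicE mem_set// mulr1.
Qed.

Let measurable_X : measurable_fun setT X.
Proof.
apply: (@measurable_fun_cvg _ _ _ setT Xg) => [n|t _]; last exact: Xg_cvg.
apply: measurable_funM; first exact: measurable_Xn.
exact: measurable_indic.
Qed.

Let integral_Xn n (f : R -> R) : continuous f ->
  (\int[U]_t (f (Xn n t))%:E = (conv_integral N B n f)%:E)%E.
Proof.
move=> cf; have mf := continuous_measurable_fun cf.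
(* The two integrands agree on [0, 1); outside, the first is f 0 and [g] is 0, but this set is
   null. *)
pose g t := \sum_(i < M n) f (nth 0 (conv_atoms R N B n) i) * \1_(cell n i) t.
have mg : measurable_fun setT g.
  by apply: measurable_sum => i; apply: measurable_funM.
rewrite (@ae_eq_integral _ _ _ U setT (EFin \o g))//; first last.
- apply: filterS ae_good => t [/= + _] _; rewrite in_itv /= => /(cell_cover n)[i iM it].
  by rewrite /g (cell_sum (fun j => f (nth 0 _ j)) iM it) /Xn (cell_sum (nth 0 _) iM it).
- exact/measurable_EFinP.
- by apply/measurable_EFinP; exact: (measurableT_comp mf (measurable_Xn n)).
rewrite /g; under eq_integral => t _ do rewrite /= -sumEFin.
rewrite integral_sum//; last first.
  move=> i; apply: eq_integrable (integrableZl measurableT (f (nth 0 (conv_atoms R N B n) i))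
    (integrable_indic U (measurable_cell n i))) => // t _.
transitivity (\sum_(i < M n) (f (nth 0 (conv_atoms R N B n) i) * (M n)%:R^-1)%:E)%E.
  apply: eq_bigr => i _; under eq_integral => t _ do rewrite EFinM.
  rewrite integralZl//; last exact: integrable_indic.
  by rewrite integral_indic// setIT [X in (_ * X)%E](U_cell (ltn_ord i)).
by rewrite sumEFin -mulr_suml mulrC /conv_integral (big_nth 0) big_mkord.
Qed.

Lemma infinite_convolution_exists :
  exists mu : probability R R, infinite_convolution_is N B mu.
Proof.
pose X' : {mfun Om >-> R} := HB.pack X (isMeasurableFun.Build _ _ _ _ X measurable_X).
exists (distribution U X') => f cf [C fC].
have mf := continuous_measurable_fun cf.
have mfX : measurable_fun setT (f \o X) by exact: (measurableT_comp mf measurable_X).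
have bint (h : R -> R) : measurable_fun setT h -> U.-integrable setT (EFin \o (f \o h)).
  move=> mh; apply: measurable_bounded_integrable => //.
  - by rewrite [ltLHS](probability_setT U) ltry.
  - exact: measurableT_comp.
  - exists C; split; first exact: num_real.
    by move=> x Cx y _ /=; rewrite (le_trans (fC _))// ltW.
rewrite integral_distribution//; last 2 first.
- exact/measurable_EFinP.
- exact: bint.
under eq_fun do rewrite -integral_Xn//.
have [] := @dominated_convergence _ _ _ U setT measurableT
  (fun n t => (f (Xn n t))%:E) (fun t => (f (X t))%:E) (cst C%:E).
- by move=> n; apply/measurable_EFinP; exact: measurableT_comp.
- exact/measurable_EFinP.
- apply: filterS ae_good => t tg _; apply: cvg_EFin; first exact: nearW.
  exact: (cvg_comp _ _ (Xn_cvgX tg) (cf (X t))).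
- by apply/integrableP; split => //; rewrite integral_cst//= [X in (_ * X)%E](probability_setT U) mule1 ltry.
- by apply: nearW => t n _; rewrite /= lee_fin.
by [].
Qed.

End Existence.

(** * Totality of the characters *)

Lemma integrable_bounded_mul (R : realType) (mu : probability R R) (h k : R -> R) (C : R) :
  mu.-integrable setT (EFin \o h) ->
  measurable_fun setT k -> (forall x, `|k x| <= C) ->
  mu.-integrable setT (EFin \o (fun x => h x * k x)).
Proof.
move=> hi mk kC; have C0 : 0 <= C by exact: le_trans (kC 0).
have mh : measurable_fun setT h by apply/measurable_EFinP; exact: (measurable_int mu).
apply: (@le_integrable _ _ _ mu setT measurableT _ (fun x => C%:E * (h x)%:E)%E).
- by apply/measurable_EFinP; exact: measurable_funM.
- move=> x _; rewrite /= lee_fin !normrM (ger0_norm C0) mulrC.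
  by rewrite ler_wpM2r.
- exact: integrableZl.
Qed.

Section FourierUniqueness.
Context (R : realType) (mu : probability R R) (f : R -> R).
Hypothesis f_int : mu.-integrable setT (EFin \o f).
Hypothesis f_hat0 : forall a,
  \int[mu]_x (f x * cos (a * x)) = 0 /\ \int[mu]_x (f x * sin (a * x)) = 0.

Let bmeas (h : R -> R) : Prop :=
  measurable_fun setT h /\ exists C : R, forall x, `|h x| <= C.

Let bmeasM h k : bmeas h -> bmeas k -> bmeas (fun x => h x * k x).
Proof.
move=> [mh [C hC]] [mk [D kD]]; split; first exact: measurable_funM.
by exists (C * D) => x; rewrite normrM ler_pM.
Qed.

Let bmeasD h k : bmeas h -> bmeas k -> bmeas (fun x => h x + k x).
Proof.
move=> [mh [C hC]] [mk [D kD]]; split; first exact: measurable_funD.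
by exists (C + D) => x; rewrite (le_trans (ler_normD _ _))// lerD.
Qed.

Let bmeas_cst (c : R) : bmeas (fun=> c).
Proof. by split; [exact: measurable_cst|exists `|c|]. Qed.

Let bmeas_cos (a b : R) : bmeas (fun x => cos (a * x + b)).
Proof.
split; last by exists 1 => x; exact: cos_max.
apply: measurableT_comp; first exact: (continuous_measurable_fun (@continuous_cos R)).
apply: measurable_funD => //; exact: measurable_funM.
Qed.

Let f_meas : measurable_fun setT f.
Proof. by apply/measurable_EFinP; exact: (measurable_int mu). Qed.

Let bmeas_int h : bmeas h -> mu.-integrable setT (EFin \o (fun x => f x * h x)).
Proof.
by move=> [mh [C hC]]; exact: integrable_bounded_mul f_int mh hC.
Qed.

(** Bounded weights h for which h f has vanishing Fourier transform; the free phase b treats cosine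
    and sine together. *)
Let null (h : R -> R) : Prop :=
  bmeas h /\ forall a b, \int[mu]_x (f x * (h x * cos (a * x + b))) = 0.

(* The multipliers form an algebra stable under bounded pointwise limits. *)
Let mult (k : R -> R) : Prop :=
  bmeas k /\ forall h, null h -> null (fun x => h x * k x).

Let eq_null h k : h =1 k -> null h -> null k.
Proof. by move=> /funext ->. Qed.

Let null1 : null (fun=> 1).
Proof.
split=> // a b.
rewrite (@eq_Rintegral _ _ _ mu setT (fun x => cos b * (f x * cos (a * x)) +
   (- sin b) * (f x * sin (a * x)))); last by move=> x _ /=; rewrite mul1r cosD; ring.
have ic : mu.-integrable setT (EFin \o (fun x => f x * cos (a * x))).
  by have := bmeas_int (bmeas_cos a 0); congr (_.-integrable _ _); apply/funext => x /=; rewrite addr0.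
have isn : mu.-integrable setT (EFin \o (fun x => f x * sin (a * x))).
  have := bmeas_int (bmeas_cos a (- (pi / 2))).
  by congr (_.-integrable _ _); apply/funext => x /=; rewrite cosBpihalf.
rewrite RintegralD//; last 2 first.
- exact: (integrableZl measurableT (cos b) ic).
- exact: (integrableZl measurableT (- sin b) isn).
rewrite RintegralZl// RintegralZl//.
by have [-> ->] := f_hat0 a; rewrite !mulr0 addr0.
Qed.

Let nullD c h k : null h -> null k -> null (fun x => c * h x + k x).
Proof.
move=> [bh nh] [bk nk]; split; first by apply: bmeasD => //; exact: bmeasM.
move=> a b; rewrite (@eq_Rintegral _ _ _ mu setT (fun x => c * (f x * (h x * cos (a * x + b))) +
   f x * (k x * cos (a * x + b)))); last by move=> x _ /=; ring.
have ih := bmeas_int (bmeasM bh (bmeas_cos a b)).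
have ik := bmeas_int (bmeasM bk (bmeas_cos a b)).
rewrite RintegralD//; last exact: (integrableZl measurableT c ih).
by rewrite RintegralZl// nh nk mulr0 addr0.
Qed.

(** Dominated convergence, with majorant C |f|. *)
Let null_lim (h_ : nat -> R -> R) h (C : R) : (forall n, null (h_ n)) ->
  (forall n x, `|h_ n x| <= C) -> (forall x, h_ ^~ x @ \oo --> h x) -> null h.
Proof.
move=> nh hC hh; have mh : measurable_fun setT h.
  by apply: (@measurable_fun_cvg _ _ _ setT h_) => [n|x _]; [case: (nh n) => -[]|exact: hh].
have bh : forall x, `|h x| <= C.
  move=> x; have : (fun n => `|h_ n x|) @ \oo --> `|h x| by apply: cvg_norm; exact: hh.
  move=> cv; rewrite -(cvg_lim _ cv)//; apply: limr_le; [exact: cvgP cv|exact: nearW].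
split; first by split => //; exists C.
move=> a b.
have bn n : bmeas (fun x => h_ n x * cos (a * x + b)) by apply: bmeasM => //; case: (nh n).
have bb : bmeas (fun x => h x * cos (a * x + b)) by apply: bmeasM => //; split => //; exists C.
have := @dominated_convergence _ _ _ mu setT measurableT
  (fun n x => (f x * (h_ n x * cos (a * x + b)))%:E)
  (fun x => (f x * (h x * cos (a * x + b)))%:E) (fun x => C%:E * `|(f x)%:E|)%E.
case.
- by move=> n; apply/measurable_EFinP; apply: measurable_funM => //; case: (bn n).
- by apply/measurable_EFinP; apply: measurable_funM => //; case: bb.
- apply: nearW => x _; apply: cvg_EFin; first exact: nearW.
  by apply: cvgM; [exact: cvg_cst|apply: cvgM; [exact: hh|exact: cvg_cst]].
- by apply: integrableZl => //; exact: integrable_abse.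
- apply: nearW => x n _; rewrite /= -EFinM lee_fin normrM mulrC ler_wpM2r//.
  by rewrite normrM -[leRHS]mulr1 ler_pM// cos_max.
move=> _ _ cv.
have zero n : (\int[mu]_x (f x * (h_ n x * cos (a * x + b)))%:E = 0)%E.
  rewrite -[LHS]fineK; last exact: (integrable_fin_num measurableT (bmeas_int (bn n))).
  by have [_ /(_ a b)] := nh n; rewrite /Rintegral => ->.
rewrite /Rintegral -(cvg_lim _ cv)// (_ : [sequence _]_n = cst 0%E).
  by rewrite lim_cst.
by apply/funext => n; rewrite /= zero.
Qed.

Let mult_cst c : mult (fun=> c).
Proof.
split=> // h nh; apply: eq_null (nullD (c - 1) nh nh) => x; ring.
Qed.

(** By the product-to-sum formula, multiplying by a cosine only translates frequencies and
    phases. *)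
Let mult_cos a b : mult (fun x => cos (a * x + b)).
Proof.
split=> // h [bh nh]; split; first exact: bmeasM.
move=> c d.
rewrite (@eq_Rintegral _ _ _ mu setT (fun x =>
   2^-1 * (f x * (h x * cos ((a + c) * x + (b + d)))) +
   2^-1 * (f x * (h x * cos ((a - c) * x + (b - d)))))); last first.
  move=> x _ /=.
  have -> : (a + c) * x + (b + d) = (a * x + b) + (c * x + d) by ring.
  have -> : (a - c) * x + (b - d) = (a * x + b) - (c * x + d) by ring.
  by move: (a * x + b) (c * x + d) => u v; rewrite cosD cosB; field.
have i1 := bmeas_int (bmeasM bh (bmeas_cos (a + c) (b + d))).
have i2 := bmeas_int (bmeasM bh (bmeas_cos (a - c) (b - d))).
rewrite RintegralD//; last 2 first.
- exact: (integrableZl measurableT 2^-1 i1).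
- exact: (integrableZl measurableT 2^-1 i2).
by rewrite !RintegralZl// !nh mulr0 addr0.
Qed.

Let multD c k l : mult k -> mult l -> mult (fun x => c * k x + l x).
Proof.
move=> [bk nk] [bl nl]; split; first by apply: bmeasD => //; exact: bmeasM.
move=> h nh; apply: eq_null (nullD c (nk _ nh) (nl _ nh)) => x; ring.
Qed.

Let multM k l : mult k -> mult l -> mult (fun x => k x * l x).
Proof.
move=> [bk nk] [bl nl]; split; first exact: bmeasM.
by move=> h nh; apply: eq_null (nl _ (nk _ nh)) => x; rewrite mulrA.
Qed.

Let mult_lim (k_ : nat -> R -> R) k (C : R) : (forall n, mult (k_ n)) ->
  (forall n x, `|k_ n x| <= C) -> (forall x, k_ ^~ x @ \oo --> k x) -> mult k.
Proof.
move=> mk kC kk; have H h : null h -> null (fun x => h x * k x).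
  move=> nh; have [[_ [D hD]] _] := nh.
  apply: (@null_lim (fun n x => h x * k_ n x) _ (D * C)).
  - by move=> n; have [_] := mk n; apply.
  - by move=> n x; rewrite normrM ler_pM.
  - by move=> x; apply: cvgM; [exact: cvg_cst|exact: kk].
split=> //; have [+ _] := H _ null1.
by rewrite (_ : (fun x => 1 * k x) = k)//; apply/funext => x; rewrite mul1r.
Qed.

Let eq_mult k l : k =1 l -> mult k -> mult l.
Proof. by move=> /funext ->. Qed.

(* The iterates of the cubic y |-> (3 y - y^3) / 2 converge to the sign on [-1, 1]. *)
Let cubic (y : R) : R := (3 * y - y ^+ 3) / 2.

Let cubicN y : cubic (- y) = - cubic y.
Proof. by rewrite /cubic; field. Qed.

Let cubic_itv y : 0 <= y <= 1 -> y <= cubic y <= 1.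
Proof.
move=> /andP[y0 y1]; apply/andP; split; rewrite -subr_ge0 /cubic.
  have -> : (3 * y - y ^+ 3) / 2 - y = y * (1 - y) * (1 + y) / 2 by field.
  by rewrite divr_ge0// !mulr_ge0 ?subr_ge0// addr_ge0.
have -> : 1 - (3 * y - y ^+ 3) / 2 = (1 - y) ^+ 2 * (2 + y) / 2 by field.
by rewrite divr_ge0// mulr_ge0 ?sqr_ge0// addr_ge0.
Qed.

Let iter_cubic_pos n y : 0 < y <= 1 ->
  y <= iter n cubic y <= 1 /\ 1 - iter n cubic y <= (1 - y / 2) ^+ n.
Proof.
move=> /andP[y0 y1]; elim: n => [|n [/andP[l1 l2] IH]].
  by rewrite /= lexx y1 expr0; split => //; rewrite gerBl ltW.
rewrite iterS; move: l1 l2 IH; set w := iter n cubic y => l1 l2 IH.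
have /andP[w1 w2] := cubic_itv (y := w) (introT andP (conj (le_trans (ltW y0) l1) l2)).
split; first by rewrite (le_trans l1 w1).
(* The last factor is 1 - (w + w^2) / 2, at most 1 - y / 2 because w >= y; hence the geometric
   rate. *)
have -> : 1 - cubic w = (1 - w) * ((1 - w) * (2 + w) / 2) by rewrite /cubic; field.
rewrite exprSr ler_pM//; [by rewrite subr_ge0| |].
  by rewrite divr_ge0// mulr_ge0 ?subr_ge0// addr_ge0// (le_trans (ltW y0)).
by nra.
Qed.

Let iter_cubicN n y : iter n cubic (- y) = - iter n cubic y.
Proof. by elim: n => //= n ->; rewrite cubicN. Qed.

Let iter_cubic_bound n y : `|y| <= 1 -> `|iter n cubic y| <= 1.
Proof.
have pos z : 0 < z <= 1 -> `|iter n cubic z| <= 1.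
  move=> z01; have [/andP[l1 l2] _] := iter_cubic_pos n z01.
  by rewrite ger0_norm// (le_trans _ l1)//; case/andP: z01 => /ltW.
rewrite ler_norml => /andP[yN y1]; have [y0|y0|<-] := ltgtP 0 y.
- by apply: pos; rewrite y0.
- by rewrite -[y]opprK iter_cubicN normrN pos// oppr_gt0 y0 lerNl.
- suff -> : iter n cubic 0 = 0 by rewrite normr0.
  by elim: n {pos} => //= n ->; rewrite /cubic; field.
Qed.

Let iter_cubic_cvg y : `|y| <= 1 -> iter n cubic y @[n --> \oo] --> Num.sg y.
Proof.
have pos z : 0 < z <= 1 -> iter n cubic z @[n --> \oo] --> (1 : R).
  move=> /[dup] z01 /andP[z0 z1].
  apply: (@squeeze_cvgr _ _ _ _ (fun n => 1 - (1 - z / 2) ^+ n) (fun=> 1)).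
  - apply: nearW => n; have [/andP[_ ->] h] := iter_cubic_pos n z01.
    by rewrite andbT lerBlDr addrC -lerBlDr.
  - rewrite -[X in _ --> X]subr0; apply: cvgB; first exact: cvg_cst.
    apply: cvg_expr; rewrite ger0_norm; lra.
  - exact: cvg_cst.
rewrite ler_norml => /andP[yN y1]; have [y0|y0|<-] := ltgtP 0 y.
- by rewrite gtr0_sg//; apply: pos; rewrite y0.
- rewrite ltr0_sg// (_ : (fun n => _) = (fun n => - iter n cubic (- y))); last first.
    by apply/funext => n; rewrite iter_cubicN opprK.
  by apply: cvgN; apply: pos; rewrite oppr_gt0 y0 lerNl.
- rewrite sgr0 (_ : (fun n => _) = cst 0); first exact: cvg_cst.
  by apply/funext; elim=> //= n ->; rewrite /cubic; field.
Qed.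

Let mult_cubic k : mult k -> mult (fun x => cubic (k x)).
Proof.
move=> mk; have m3 := multM mk (multM mk mk).
apply: eq_mult (multD (- 2^-1) m3 (multD (3 / 2) mk (mult_cst 0))) => x.
by rewrite /cubic; field.
Qed.

(** Polynomials in a cosine are multipliers, and the cubic iterates turn the cosine into a square
    wave in the limit. *)
Let mult_sg_cos a b : mult (fun x => Num.sg (cos (a * x + b))).
Proof.
apply: (@mult_lim (fun n x => iter n cubic (cos (a * x + b))) _ 1).
- by elim=> [|n IH]; [exact: mult_cos|exact: (mult_cubic IH)].
- by move=> n x; apply: iter_cubic_bound; exact: cos_max.
- by move=> x; apply: iter_cubic_cvg; exact: cos_max.
Qed.

(** Stretched square waves leave a single jump: sin ((x - c) / (n + 1)) has the sign of x - c once
    |x - c| < pi (n + 1). *)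
Let mult_sg c : mult (fun x => Num.sg (x - c)).
Proof.
apply: (@mult_lim (fun n x => Num.sg (sin ((x - c) / n.+1%:R))) _ 1).
- move=> n; apply: eq_mult (mult_sg_cos n.+1%:R^-1 (- c / n.+1%:R - pi / 2)) => x.
  by rewrite addrA cosBpihalf; congr (Num.sg (sin _)); ring.
- by move=> n x; rewrite normr_sg; case: (_ != _); rewrite ?ler01.
move=> x; apply: cvg_near_cst.
have pi0 : 0 < pi :> R := pi_gt0 R.
have [K HK] : exists K : nat, `|x - c| / pi < K%:R.
  by exists (Num.truncn (`|x - c| / pi)).+1; exact: truncnS_gt.
exists K => // n /= Kn.
have small : `|x - c| / n.+1%:R < pi.
  rewrite ltr_pdivrMr// mulrC -ltr_pdivrMr//; apply: lt_le_trans HK _.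
  by rewrite ler_nat (leq_trans Kn).
have [xc|xc|xc] := ltgtP 0 (x - c).
- rewrite (gtr0_sg xc) gtr0_sg//; apply: sin_gt0_pi.
  by rewrite divr_gt0//=; rewrite gtr0_norm in small.
- rewrite (ltr0_sg xc) ltr0_sg// -[x - c]opprK mulNr sinN oppr_lt0; apply: sin_gt0_pi.
  by rewrite divr_gt0 ?oppr_gt0//=; rewrite ltr0_norm in small.
- by rewrite -xc mul0r sin0.
Qed.

(** For s = sg (x - c), the indicator of s > 0 is (s + s^2) / 2. *)
Let mult_ray c : mult (\1_(`]c, +oo[%classic)).
Proof.
have ms := mult_sg c.
apply: eq_mult (multD 2^-1 ms (multD 2^-1 (multM ms ms) (mult_cst 0))) => x.
have -> : \1_(`]c, +oo[%classic) x = (c < x)%R%:R :> R.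
  rewrite indicE; congr (nat_of_bool _)%:R.
  by apply/idP/idP => [/set_mem|cx]; [|apply/mem_set]; rewrite /= in_itv /= andbT.
have [xc|xc|xc] := ltgtP c x.
- by rewrite gtr0_sg ?subr_gt0//=; field.
- by rewrite ltr0_sg ?subr_lt0//=; field.
- by rewrite xc subrr sgr0 /=; ring.
Qed.

(** Complements come from 1 - 1_A; the indicator of a countable union is the limit of 1 minus the
    finite products of the 1 - 1_(A_i). *)
Let mult_sigma_algebra : sigma_algebra setT [set A : set R | mult (\1_A)].
Proof.
have mC (A : set R) : mult (\1_A) -> mult (fun x => 1 - \1_A x).
  by move=> mA; apply: eq_mult (multD (-1) mA (mult_cst 1)) => x; ring.
split=> /=.
- by apply: eq_mult (mult_cst 0) => x; rewrite indic0.
- move=> A mA; apply: eq_mult (mC _ mA) => x; rewrite setTD !indicE in_setC.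
  by case: (x \in A) => /=; rewrite ?subrr ?subr0.
move=> A mA.
apply: (@mult_lim (fun n x => 1 - \prod_(i < n) (1 - \1_(A i) x)) _ 1).
- move=> n; suff mp : mult (fun x => \prod_(i < n) (1 - \1_(A i) x)).
    by apply: eq_mult (multD (-1) mp (mult_cst 1)) => x; ring.
  elim: n => [|n IH]; first by apply: eq_mult (mult_cst 1) => x; rewrite big_ord0.
  by apply: eq_mult (multM IH (mC _ (mA n))) => x; rewrite big_ord_recr.
- move=> n x.
  have b01 (i : 'I_n) : 0 <= (1 - \1_(A i) x : R) <= 1.
    by rewrite indicE; case: (x \in A i); rewrite ?subrr ?subr0 ?lexx ?ler01.
  have p0 : 0 <= \prod_(i < n) (1 - \1_(A i) x : R).
    by apply: prodr_ge0 => i _; case/andP: (b01 i).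
  have p1 : \prod_(i < n) (1 - \1_(A i) x : R) <= 1 by exact: prodr_ile1.
  by rewrite ger0_norm; lra.
move=> x; apply: cvg_near_cst; rewrite indicE.
have [[i _ Aix]|nA] := pselect ((\bigcup_k A k) x).
  rewrite mem_set; last by exists i.
  exists i.+1 => // n /= ni; rewrite (bigD1 (Ordinal ni))//= indicE mem_set//.
  by rewrite subrr mul0r subr0.
rewrite memNset//; apply: nearW => n; rewrite big1 ?subrr// => i _.
by rewrite indicE memNset ?subr0// => Aix; apply: nA; exists i.
Qed.

(** Open rays generate the Borel sets, so every Borel indicator is a multiplier and f integrates to
    0 over every Borel set. *)
Lemma fourier_unique : {ae mu, forall x, f x = 0}.
Proof.
have mall (A : set R) : measurable A -> mult (\1_A).
  rewrite -[measurable A]/((@ocitv R).-sigma.-measurable A) RGenOInfty.measurableE.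
  have GX : @RGenOInfty.G R `<=` [set A | mult (\1_A)] by move=> _ [c ->]; exact: mult_ray.
  exact: (smallest_sub mult_sigma_algebra GX).
have := @integral_ae_eq _ _ _ mu setT measurableT (cst 0%E) (EFin \o f) f_int.
move=> H; have {}H : ae_eq mu setT (EFin \o f) (cst 0%E).
  apply: H; first exact: measurable_cst.
  move=> E _ mE; rewrite integral0 integral_mkcond.
  have [_ nE] := mall _ mE; have [bE /(_ 0 0)] := nE _ null1.
  rewrite /Rintegral => e.
  rewrite (_ : (fun x => _) = (fun x => (f x * (1 * \1_E x * cos (0 * x + 0)))%:E)).
    rewrite -[LHS]fineK ?e//; apply: (integrable_fin_num measurableT).
    exact: (bmeas_int (bmeasM bE (bmeas_cos 0 0))).
  apply/funext => x; rewrite /patch /= indicE mul0r addr0 cos0 mulr1 mul1r.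
  by case: (x \in E); rewrite ?mulr1 ?mulr0.
by apply: filterS H => x /(_ Logic.I) [].
Qed.

End FourierUniqueness.

(** * Projection onto the span of orthogonal characters *)

Section ComplexIntegral.
Context (R : realType) (mu : probability R R).
Implicit Types F G : R -> R[i].

Definition cintegral F : R[i] :=
  Complex (\int[mu]_x complex.Re (F x)) (\int[mu]_x complex.Im (F x)).

Definition cintegrable F : Prop :=
  mu.-integrable setT (EFin \o (fun x => complex.Re (F x))) /\
  mu.-integrable setT (EFin \o (fun x => complex.Im (F x))).

Definition cbounded F : Prop :=
  [/\ measurable_fun setT (fun x => complex.Re (F x)),
      measurable_fun setT (fun x => complex.Im (F x)) &
      exists C : R, forall x, nrm2 (F x) <= C].

Lemma eq_cintegral F G : F =1 G -> cintegral F = cintegral G.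
Proof. by move=> /funext ->. Qed.

Lemma cintegrableD F G : cintegrable F -> cintegrable G ->
  cintegrable (fun x => F x + G x).
Proof.
move=> [F1 F2] [G1 G2]; split.
  have := integrableD measurableT F1 G1; congr (_.-integrable _ _).
  by apply/funext => x /=; case: (F x) (G x) => [? ?] [? ?].
have := integrableD measurableT F2 G2; congr (_.-integrable _ _).
by apply/funext => x /=; case: (F x) (G x) => [? ?] [? ?].
Qed.

Lemma cintegralD F G : cintegrable F -> cintegrable G ->
  cintegral (fun x => F x + G x) = cintegral F + cintegral G.
Proof.
move=> [F1 F2] [G1 G2]; rewrite /cintegral.
rewrite [RHS](_ : _ = Complex (\int[mu]_x complex.Re (F x) + \int[mu]_x complex.Re (G x))
  (\int[mu]_x complex.Im (F x) + \int[mu]_x complex.Im (G x)))//.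
rewrite -!RintegralD//; congr Complex; apply: eq_Rintegral => x _;
  by case: (F x) (G x) => [? ?] [? ?].
Qed.

Lemma integrable_lin (f g : R -> R) (a b : R) :
  mu.-integrable setT (EFin \o f) -> mu.-integrable setT (EFin \o g) ->
  mu.-integrable setT (EFin \o (fun x => a * f x + b * g x)) /\
  \int[mu]_x (a * f x + b * g x) = a * \int[mu]_x f x + b * \int[mu]_x g x.
Proof.
move=> fi gi; have ai := integrableZl measurableT a fi; have bi := integrableZl measurableT b gi.
split; first exact: (integrableD measurableT ai bi).
by rewrite RintegralD// !RintegralZl.
Qed.

Lemma cintegrableZ (c : R[i]) F : cintegrable F -> cintegrable (fun x => c * F x).
Proof.
case: c => a b [F1 F2]; split.
  have [+ _] := integrable_lin a (- b) F1 F2; congr (_.-integrable _ _).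
  by apply/funext => x /=; case: (F x) => ? ? /=; rewrite mulNr.
have [+ _] := integrable_lin a b F2 F1; congr (_.-integrable _ _).
by apply/funext => x /=; case: (F x) => ? ? /=.
Qed.

Lemma cintegralZ (c : R[i]) F : cintegrable F ->
  cintegral (fun x => c * F x) = c * cintegral F.
Proof.
case: c => a b [F1 F2]; rewrite /cintegral.
have [_ e1] := integrable_lin a (- b) F1 F2; have [_ e2] := integrable_lin a b F2 F1.
rewrite [RHS](_ : _ = Complex (a * \int[mu]_x complex.Re (F x) + (- b) * \int[mu]_x complex.Im (F x))
  (a * \int[mu]_x complex.Im (F x) + b * \int[mu]_x complex.Re (F x)))//; last by rewrite mulNr.
rewrite -e1 -e2; congr Complex; apply: eq_Rintegral => x _;
  by case: (F x) => ? ? /=; rewrite ?mulNr.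
Qed.

Lemma cintegrable0 : cintegrable (fun=> 0).
Proof. by split; exact: integrable0. Qed.

Lemma cintegral0 : cintegral (fun=> 0) = 0.
Proof. by rewrite /cintegral /= Rintegral_cst// mul0r. Qed.

Lemma cintegral_sum (I : Type) (s : seq I) (F : I -> R -> R[i]) :
  (forall i, cintegrable (F i)) ->
  cintegrable (fun x => \sum_(i <- s) F i x) /\
  cintegral (fun x => \sum_(i <- s) F i x) = \sum_(i <- s) cintegral (F i).
Proof.
move=> Fi; elim: s => [|i s [IH1 IH2]].
  rewrite (_ : (fun x => \sum_(i <- [::]) F i x) = (fun=> 0)).
    by rewrite big_nil cintegral0; split => //; exact: cintegrable0.
  by apply/funext => x; rewrite big_nil.
rewrite (_ : (fun x => \sum_(j <- i :: s) F j x) = (fun x => F i x + \sum_(j <- s) F j x)).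
  by split; [exact: cintegrableD|rewrite cintegralD// IH2 big_cons].
by apply/funext => x; rewrite big_cons.
Qed.

Lemma nrm2_bound F C : (forall x, nrm2 (F x) <= C) ->
  forall x, `|complex.Re (F x)| <= C + 1 /\ `|complex.Im (F x)| <= C + 1.
Proof.
move=> FC x; have := FC x; rewrite /nrm2.
move: (complex.Re _) (complex.Im _) => a b ab.
have key (y z : R) : y ^+ 2 + z ^+ 2 <= C -> `|y| <= C + 1.
  move=> yz; rewrite ler_norml; apply/andP.
  have := sqr_ge0 z; have := sqr_ge0 (y - 1); have := sqr_ge0 (y + 1).
  split; nra.
by split; [exact: key ab|apply: (key b a); rewrite addrC].
Qed.

Lemma cintegrable_bounded_mul F G : cintegrable F -> cbounded G ->
  cintegrable (fun x => F x * G x).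
Proof.
move=> [F1 F2] [G1 G2 [C GC]].
have b1 x : `|complex.Re (G x)| <= C + 1 by case: (nrm2_bound GC x).
have b2 x : `|complex.Im (G x)| <= C + 1 by case: (nrm2_bound GC x).
split.
  have [+ _] := integrable_lin 1 (-1) (integrable_bounded_mul F1 G1 b1)
    (integrable_bounded_mul F2 G2 b2); congr (_.-integrable _ _).
  by apply/funext => x /=; case: (F x) (G x) => [? ?] [? ?] /=; rewrite mul1r mulN1r.
have [+ _] := integrable_lin 1 1 (integrable_bounded_mul F1 G2 b2)
  (integrable_bounded_mul F2 G1 b1); congr (_.-integrable _ _).
by apply/funext => x /=; case: (F x) (G x) => [? ?] [? ?] /=; congr EFin; ring.
Qed.

Lemma cintegrable1 : cintegrable (fun=> 1).
Proof.
have ci (c : R) : mu.-integrable setT (EFin \o (fun=> c)).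
  apply: measurable_bounded_integrable => //; first by rewrite [ltLHS](probability_setT mu) ltry.
  by exists `|c|; split; [exact: num_real|move=> x cx y _ /=; exact: ltW].
by split; exact: ci.
Qed.

Lemma cintegral1 : cintegral (fun=> 1) = 1.
Proof.
rewrite /cintegral /= !Rintegral_cst// mul0r mul1r.
by rewrite [X in fine X](probability_setT mu).
Qed.

Lemma cbounded_integrable F : cbounded F -> cintegrable F.
Proof.
move=> bF; have := cintegrable_bounded_mul cintegrable1 bF.
by rewrite (_ : (fun x => 1 * F x) = F)//; apply/funext => x; rewrite mul1r.
Qed.

(** * Characters and the residuals of their projections *)

Definition expch (t x : R) : R[i] := cexpi (2 * pi * t * x).

Arguments expch : simpl never.

Lemma expch_bounded t : cbounded (expch t).
Proof.
have ml : measurable_fun setT (fun x : R => 2 * pi * t * x) by exact: measurable_funM.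
split.
- exact: (measurableT_comp (continuous_measurable_fun (@continuous_cos R)) ml).
- exact: (measurableT_comp (continuous_measurable_fun (@continuous_sin R)) ml).
- by exists 1 => x; rewrite nrm2_cexpi.
Qed.

Lemma expchD s t x : expch (s + t) x = expch s x * expch t x.
Proof. by rewrite /expch mulrDr mulrDl cexpiD. Qed.

Lemma expch0 x : expch 0 x = 1.
Proof. by rewrite /expch mulr0 mul0r /cexpi cos0 sin0. Qed.

Lemma expchN t x : expch (- t) x = conjc (expch t x).
Proof. by rewrite /expch mulrN mulNr /cexpi cosN sinN. Qed.

Definition mucf (t : R) : R[i] := cintegral (expch t).

Lemma mucf0 : mucf 0 = 1.
Proof.
by rewrite /mucf (eq_cintegral (G := fun=> 1)) ?cintegral1//; exact: expch0.
Qed.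

Lemma mucfN t : mucf (- t) = conjc (mucf t).
Proof.
rewrite /mucf /cintegral -[RHS]/(Complex (\int[mu]_x complex.Re (expch t x))
  (- \int[mu]_x complex.Im (expch t x))); congr Complex.
  by apply: eq_Rintegral => x _; rewrite expchN.
rewrite -[RHS]mulN1r -RintegralZl//; last first.
  by case: (cbounded_integrable (expch_bounded t)).
by apply: eq_Rintegral => x _; rewrite expchN /= mulN1r.
Qed.

(** Holds since |w| <= 1 + w^2 and mu is finite. *)
Lemma integrable_of_sqr (w : R -> R) : measurable_fun setT w ->
  mu.-integrable setT (fun x => (w x ^+ 2)%:E) -> mu.-integrable setT (EFin \o w).
Proof.
move=> mw w2; have i1 : mu.-integrable setT (EFin \o (fun x => 1 * 1 + 1 * w x ^+ 2)).
  have [c1 _] := cintegrable1.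
  by have [+ _] := @integrable_lin (fun=> 1) (fun x => w x ^+ 2) 1 1 c1 w2.
apply: (le_integrable measurableT _ _ i1); first exact/measurable_EFinP.
move=> x _; rewrite /= lee_fin [leRHS]ger0_norm; last first.
  by rewrite addr_ge0// ?mul1r ?sqr_ge0.
rewrite ler_norml; have := sqr_ge0 (w x - 1); have := sqr_ge0 (w x + 1).
by move=> ? ?; apply/andP; split; nra.
Qed.

(** The coefficient [mucf (t - l)] is the inner product of the characters of frequencies t and l;
    for orthogonal characters this is what remains of the first after projection onto the span of
    [s]. *)
Definition residual (s : seq R) (t x : R) : R[i] :=
  expch t x - \sum_(l <- s) mucf (t - l) * expch l x.

Let nrm2C (z : R[i]) : z * conjc z = Complex (nrm2 z) 0.
Proof.
case: z => a b; apply/eqP; rewrite eq_complex /= /nrm2 /=.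
by apply/andP; split; apply/eqP; ring.
Qed.

Lemma residual_nrm2 (s : seq R) t : uniq s ->
  {in s &, forall l l', l != l' -> mucf (l - l') = 0} ->
  mu.-integrable setT (EFin \o (fun x => nrm2 (residual s t x))) /\
  \int[mu]_x nrm2 (residual s t x) = 1 - \sum_(l <- s) nrm2 (mucf (t - l)).
Proof.
move=> us orth; pose a l := mucf (t - l).
pose T1 x := \sum_(l <- s) (- conjc (a l)) * expch (t - l) x.
pose T2 x := \sum_(l <- s) (- a l) * expch (l - t) x.
pose T3 x := \sum_(l <- s) \sum_(l' <- s) a l * conjc (a l') * expch (l - l') x.
have eiZ c r : cintegrable (fun x => c * expch r x).
  by apply: cintegrableZ; exact/cbounded_integrable/expch_bounded.
have ex r : cintegrable (expch r) by exact/cbounded_integrable/expch_bounded.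
have [i1 e1] := cintegral_sum s (fun l => eiZ (- conjc (a l)) (t - l)).
have [i2 e2] := cintegral_sum s (fun l => eiZ (- a l) (l - t)).
have [i3 e3] := cintegral_sum s (fun l =>
  (cintegral_sum s (fun l' => eiZ (a l * conjc (a l')) (l - l'))).1).
have E x : residual s t x * conjc (residual s t x) = (1 + T1 x) + (T2 x + T3 x).
  have cR : conjc (residual s t x) =
      expch (- t) x - \sum_(l <- s) conjc (a l) * expch (- l) x.
    rewrite /residual rmorphB rmorph_sum expchN; congr (_ - _).
    by apply: eq_bigr => l _; rewrite rmorphM expchN.
  rewrite cR /residual; set S := \sum_(l <- s) mucf _ * _.
  rewrite mulrBl !mulrBr -expchD subrr expch0.
  have -> : T1 x = - (expch t x * \sum_(l <- s) conjc (a l) * expch (- l) x).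
    rewrite mulr_sumr -sumrN; apply: eq_bigr => l _.
    by rewrite expchD mulNr mulrCA.
  have -> : T2 x = - (S * expch (- t) x).
    rewrite mulr_suml -sumrN; apply: eq_bigr => l _.
    by rewrite expchD mulNr mulrA.
  have -> : T3 x = S * \sum_(l <- s) conjc (a l) * expch (- l) x.
    rewrite mulr_suml; apply: eq_bigr => l _; rewrite mulr_sumr; apply: eq_bigr => l' _.
    by rewrite expchD -/(a l) mulrACA.
  by ring.
have c1 := cintegrable1.
have iD := cintegrableD (cintegrableD c1 i1) (cintegrableD i2 i3).
have vD := cintegralD (cintegrableD c1 i1) (cintegrableD i2 i3).
rewrite (cintegralD c1 i1) (cintegralD i2 i3) e1 e2 e3 in vD.
have eqF : (fun x => (1 + T1 x) + (T2 x + T3 x)) = (fun x => Complex (nrm2 (residual s t x)) 0).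
  by apply/funext => x; rewrite -E nrm2C.
rewrite -/T1 -/T2 -/T3 eqF in iD vD.
split; first by case: iD.
have : cintegral (fun x => Complex (nrm2 (residual s t x)) 0) =
    Complex (1 - \sum_(l <- s) nrm2 (mucf (t - l))) 0; last by move=> /(congr1 (@complex.Re R)).
rewrite vD.
rewrite cintegral1.
have sC : Complex (\sum_(l <- s) nrm2 (mucf (t - l))) 0 = \sum_(l <- s) a l * conjc (a l) :> R[i].
  rewrite (eq_bigr (fun l => real_complex R (nrm2 (a l)))) => [|l _]; last exact: nrm2C.
  by rewrite -rmorph_sum.
have -> : Complex (1 - \sum_(l <- s) nrm2 (mucf (t - l))) 0 =
    1 - \sum_(l <- s) a l * conjc (a l) :> R[i].
  by rewrite -sC; apply/eqP; rewrite eq_complex /= subr0 !eqxx.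
have -> : \sum_(l <- s) cintegral (fun x => - conjc (a l) * expch (t - l) x) =
    - \sum_(l <- s) a l * conjc (a l).
  by rewrite -sumrN; apply: eq_bigr => l _; rewrite cintegralZ// mulNr mulrC.
have -> : \sum_(l <- s) cintegral (fun x => - a l * expch (l - t) x) =
    - \sum_(l <- s) a l * conjc (a l).
  rewrite -sumrN; apply: eq_bigr => l _; rewrite cintegralZ// mulNr.
  by rewrite -[cintegral _]/(mucf _) -opprB mucfN.
have -> : \sum_(l <- s) cintegral (fun x => \sum_(l' <- s) a l * conjc (a l') * expch (l - l') x) =
    \sum_(l <- s) a l * conjc (a l).
  rewrite big_seq [RHS]big_seq; apply: eq_bigr => l ls.
  rewrite (cintegral_sum s (fun l' => eiZ (a l * conjc (a l')) (l - l'))).2.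
  rewrite (bigD1_seq l)//= big_seq_cond big1 ?addr0; last first.
    move=> l' /andP[ls' l'l]; rewrite cintegralZ// -[cintegral _]/(mucf _) orth ?mulr0//.
    by rewrite eq_sym.
  by rewrite cintegralZ// -[cintegral _]/(mucf _) subrr mucf0 mulr1.
by ring.
Qed.

Lemma residual_bounded s t : cbounded (residual s t).
Proof.
have bD F G : cbounded F -> cbounded G -> cbounded (fun x => F x + G x).
  move=> [F1 F2 [C FC]] [G1 G2 [D GD]]; split.
  - rewrite (_ : (fun x => _) = (fun x => complex.Re (F x) + complex.Re (G x))).
      exact: measurable_funD.
    by apply/funext => x; case: (F x) (G x) => [? ?] [? ?].
  - rewrite (_ : (fun x => _) = (fun x => complex.Im (F x) + complex.Im (G x))).
      exact: measurable_funD.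
    by apply/funext => x; case: (F x) (G x) => [? ?] [? ?].
  - exists (2 * (C + D)) => x; have := FC x; have := GD x; rewrite /nrm2.
    case: (F x) (G x) => [p q] [p' q'] /=.
    have := sqr_ge0 (p - p'); have := sqr_ge0 (q - q'); nra.
have bZ c F : cbounded F -> cbounded (fun x => c * F x).
  case: c => a b [F1 F2 [C FC]]; split.
  - rewrite (_ : (fun x => _) = (fun x => a * complex.Re (F x) - b * complex.Im (F x))).
      by apply: measurable_funB; exact: measurable_funM.
    by apply/funext => x; case: (F x).
  - rewrite (_ : (fun x => _) = (fun x => a * complex.Im (F x) + b * complex.Re (F x))).
      by apply: measurable_funD; exact: measurable_funM.
    by apply/funext => x; case: (F x).
  - by exists (nrm2 (Complex a b) * C) => x; rewrite nrm2M ler_wpM2l// nrm2_ge0.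
rewrite /residual; elim: s => [|l s IH].
  rewrite (_ : (fun x => _) = expch t); first exact: expch_bounded.
  by apply/funext => x; rewrite big_nil subr0.
rewrite (_ : (fun x => _) = (fun x => (expch t x - \sum_(l <- s) mucf (t - l) * expch l x)
   + (- mucf (t - l)) * expch l x)).
  by apply: bD => //; apply: bZ; exact: expch_bounded.
by apply/funext => x; rewrite big_cons opprD mulNr addrAC addrA.
Qed.

(* The coefficients [mucf (t - l)] project a character onto the span of the
   characters in s; if the residuals tend to 0, then orthogonality to the span
   passes to every character. *)
Lemma orthogonal_expch (u v : R -> R) t :
  measurable_fun setT u -> measurable_fun setT v ->
  mu.-integrable setT (fun x => (u x ^+ 2)%:E) ->
  mu.-integrable setT (fun x => (v x ^+ 2)%:E) ->
  (forall h, 0 < h -> exists s : seq R, [/\ uniq s,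
     {in s &, forall l l', l != l' -> mucf (l - l') = 0},
     {in s, forall l, cintegral (fun x => Complex (u x) (v x) * expch l x) = 0} &
     1 - \sum_(l <- s) nrm2 (mucf (t - l)) <= h]) ->
  cintegral (fun x => Complex (u x) (v x) * expch t x) = 0.
Proof.
move=> mu_ mv u2 v2 H; pose G x := Complex (u x) (v x).
have Gi : cintegrable G by split; exact: integrable_of_sqr.
have GE l : cintegrable (fun x => G x * expch l x).
  by apply: cintegrable_bounded_mul => //; exact: expch_bounded.
pose W := \int[mu]_x (1 * u x ^+ 2 + 1 * v x ^+ 2).
have [Wi _] := @integrable_lin (fun x => u x ^+ 2) (fun x => v x ^+ 2) 1 1 u2 v2.
have W0 : 0 <= W.
  by apply: Rintegral_ge0 => x _; rewrite !mul1r addr_ge0 ?sqr_ge0.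
have bound (z : R) : (forall r h, 0 < r -> 0 < h -> `|z| <= r * W + h / r) -> z = 0.
  move=> Hz; apply/eqP; rewrite -normr_le0; apply/ler_addgt0Pl => e e0; rewrite addr0.
  (* This r makes r W at most e / 2, and the choice h = r e / 2 makes h / r equal to e / 2. *)
  pose r := e / (2 * (W + 1)).
  have r0 : 0 < r by rewrite divr_gt0// mulr_gt0// ltr_wpDl.
  have h0 : 0 < r * (e / 2) by rewrite mulr_gt0// divr_gt0.
  apply: (le_trans (Hz r (r * (e / 2)) r0 h0)).
  have -> : r * (e / 2) / r = e / 2 by rewrite mulrAC mulfV ?gt_eqF// mul1r.
  have : r * W <= e / 2.
    rewrite /r mulrAC ler_pdivrMr; last by rewrite mulr_gt0// ltr_wpDl.
    by nra.
  lra.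
suff key r h : 0 < r -> 0 < h ->
    `|complex.Re (cintegral (fun x => G x * expch t x))| <= r * W + h / r /\
    `|complex.Im (cintegral (fun x => G x * expch t x))| <= r * W + h / r.
  apply/eqP; rewrite eq_complex /=; apply/andP; split; apply/eqP; apply: bound => r h r0 h0;
    by case: (key r h r0 h0).
move=> r0 h0; have [s [us os zs sh]] := H h h0.
have [Di De] := residual_nrm2 t us os.
pose D := residual s t.
(* G integrates to 0 against each character in [s], so subtracting the projection does not change
   the integral. *)
have eD : cintegral (fun x => G x * expch t x) = cintegral (fun x => G x * D x).
  have iZ l : cintegrable (fun x => mucf (t - l) * (G x * expch l x)) by exact: cintegrableZ.
  have [si se] := cintegral_sum s iZ.
  have GD : cintegrable (fun x => G x * D x).
    by apply: cintegrable_bounded_mul => //; exact: residual_bounded.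
  rewrite (eq_cintegral (G := fun x => G x * D x + \sum_(l <- s) mucf (t - l) * (G x * expch l x))).
    rewrite cintegralD// se big_seq big1 ?addr0// => l ls.
    by rewrite cintegralZ// zs// mulr0.
  move=> x; rewrite /D /residual mulrBr mulr_sumr [X in _ - X](eq_bigr (fun l => mucf (t - l) * (G x * expch l x))).
    by rewrite subrK.
  by move=> l _; rewrite mulrCA.
have [GD1 GD2] : cintegrable (fun x => G x * D x).
  by apply: cintegrable_bounded_mul => //; exact: residual_bounded.
have [bi be] := integrable_lin r r^-1 Wi Di.
have bnd : r * W + r^-1 * \int[mu]_x nrm2 (D x) <= r * W + h / r.
  by rewrite lerD2l mulrC ler_pM2r ?invr_gt0// /D De.
rewrite eD /cintegral /=.
(* The weighted arithmetic-geometric mean inequality, used pointwise in place of Cauchy-Schwarz. *)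
have amgm (p q P Q : R) : `|p * P - q * Q| <= r * (1 * p ^+ 2 + 1 * q ^+ 2) + r^-1 * (P ^+ 2 + Q ^+ 2).
  have ri : r * r^-1 = 1 by rewrite mulfV// gt_eqF.
  have ri0 : 0 < r^-1 by rewrite invr_gt0.
  have e1 (y z : R) : `|y * z| <= r * y ^+ 2 + r^-1 * z ^+ 2.
    have s1 : 0 <= r^-1 * (r * y - z) ^+ 2 by rewrite mulr_ge0 ?sqr_ge0// ltW.
    have s2 : 0 <= r^-1 * (r * y + z) ^+ 2 by rewrite mulr_ge0 ?sqr_ge0// ltW.
    have x1 : r^-1 * (r * y - z) ^+ 2 = r * y ^+ 2 + r^-1 * z ^+ 2 - 2 * (y * z).
      by field; rewrite gt_eqF.
    have x2 : r^-1 * (r * y + z) ^+ 2 = r * y ^+ 2 + r^-1 * z ^+ 2 + 2 * (y * z).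
      by field; rewrite gt_eqF.
    have ry : 0 <= r * y ^+ 2 by rewrite mulr_ge0 ?sqr_ge0// ltW.
    have rz : 0 <= r^-1 * z ^+ 2 by rewrite mulr_ge0 ?sqr_ge0// ltW.
    rewrite ler_norml; apply/andP; split; lra.
  apply: (le_trans (ler_normB _ _)).
  by have := e1 p P; have := e1 q Q; lra.
have est (F : R -> R) : mu.-integrable setT (EFin \o F) ->
    (forall x, `|F x| <= r * (1 * u x ^+ 2 + 1 * v x ^+ 2) + r^-1 * nrm2 (D x)) ->
    `|\int[mu]_x F x| <= r * W + h / r.
  move=> Fi FB; apply: (le_trans (le_normr_Rintegral measurableT Fi)).
  apply: le_trans bnd; rewrite /W -be; apply: le_Rintegral => //.
  - exact: (integrable_norm Fi).
split; apply: est => // x; rewrite /nrm2.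
  by case: (D x) => P Q /=; exact: amgm.
case: (D x) => P Q /=; have := amgm (v x) (u x) P (- Q).
rewrite mulrN opprK sqrrN [v x * P + _]addrC.
by move=> /le_trans; apply; lra.
Qed.

End ComplexIntegral.

(** * Parseval identity for the infinite convolution *)

Section Spectrum.
Context (R : realType) (N : nat -> int) (B : nat -> seq int).
Context (mu : probability R R) (L : nat -> seq int).
Hypothesis N_ge2 : forall n, 2 <= N n.
Hypothesis B_gt0 : forall n, (0 < size (B n))%N.
Hypothesis mu_conv : infinite_convolution_is N B mu.
Hypothesis L0 : forall n, 0 \in L n.
Hypothesis L_pars : forall n (x : R),
  \sum_(l <- L n) nrm2 (mhat (B n) (x + l%:~R / (N n)%:~R)) = 1.

Let N_gt0 n : 0 < N n.
Proof. exact: lt_le_trans (N_ge2 n). Qed.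

Let Lm := Lam N L.

Let Lm_sub m n : (m <= n)%N -> {subset Lm m <= Lm n}.
Proof. exact: (Lam_sub N_gt0 L0). Qed.

Let Lm_uniq n : uniq (Lm n).
Proof. exact: (Lam_uniq N_gt0 L_pars B_gt0). Qed.

Lemma dexp_cvg (f : R -> R) : continuous f -> (exists C, forall x, `|f x| <= C) ->
  dexp N B 0 n f @[n --> \oo] --> \int[mu]_x f x.
Proof.
move=> cf [C fC]; have fi : mu.-integrable setT (EFin \o f).
  apply: measurable_bounded_integrable => //.
  - by rewrite [ltLHS](probability_setT mu) ltry.
  - exact: continuous_measurable_fun.
  - by exists C; split; [exact: num_real|move=> x cx y _ /=; rewrite (le_trans (fC y))// ltW].
have := mu_conv cf (ex_intro _ C fC).
rewrite -[X in _ --> X]fineK; last exact: (integrable_fin_num measurableT fi).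
move=> /fine_cvg; rewrite (_ : fine \o _ = (fun n => dexp N B 0 n f))//.
by apply/funext => n; rewrite /= conv_integral_dexp.
Qed.

Lemma muhat_cvg (t : R) :
  (complex.Re (muhat N B 0 n t) @[n --> \oo] --> complex.Re (mucf mu t)) /\
  (complex.Im (muhat N B 0 n t) @[n --> \oo] --> complex.Im (mucf mu t)).
Proof.
have cl : continuous (fun x : R => 2 * pi * t * x).
  by move=> x; apply: cvgM; [exact: cvg_cst|exact: cvg_id].
split; apply: dexp_cvg.
- by move=> x; apply: continuous_comp; [exact: cl|exact: continuous_cos].
- by exists 1 => x; exact: cos_max.
- by move=> x; apply: continuous_comp; [exact: cl|exact: continuous_sin].
- by exists 1 => x; exact: sin_max.
Qed.

Lemma nrm2_muhat_cvg (t : R) :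
  nrm2 (muhat N B 0 n t) @[n --> \oo] --> nrm2 (mucf mu t).
Proof.
have [c1 c2] := muhat_cvg t.
have sq (w : nat -> R) (a : R) : w n @[n --> \oo] --> a -> w n ^+ 2 @[n --> \oo] --> a ^+ 2.
  by move=> wa; under eq_fun do rewrite expr2; rewrite expr2; exact: cvgM.
by apply: cvgD; exact: sq.
Qed.

(** For n >= m both frequencies lie in the spectrum of mu_n, whose transform vanishes at their
    difference; the limit inherits this. *)
Lemma mucf_orth m : {in Lm m &, forall x y : int, x != y ->
  mucf mu (x%:~R - y%:~R) = 0}.
Proof.
move=> x y xm ym xy; have [c1 c2] := muhat_cvg (x%:~R - y%:~R).
have ev : \forall n \near \oo, muhat N B 0 n (x%:~R - y%:~R) = 0 :> R[i].
  exists m => // n /= mn; rewrite -rmorphB.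
  by apply: (Lam_orth N_gt0 L_pars B_gt0) => //; exact: (Lm_sub mn).
have z1 : complex.Re (muhat N B 0 n (x%:~R - y%:~R)) @[n --> \oo] --> (0 : R).
  by apply: cvg_near_cst; apply: filterS ev => n ->.
have z2 : complex.Im (muhat N B 0 n (x%:~R - y%:~R)) @[n --> \oo] --> (0 : R).
  by apply: cvg_near_cst; apply: filterS ev => n ->.
have e1 := cvg_unique (@Rhausdorff R) c1 z1; have e2 := cvg_unique (@Rhausdorff R) c2 z2.
by apply/eqP; rewrite eq_complex e1 e2 /= eqxx.
Qed.

Lemma nrm2_mucf_sym (s t : R) : nrm2 (mucf mu (s - t)) = nrm2 (mucf mu (t - s)).
Proof.
by rewrite -opprB mucfN; case: (mucf mu _) => a b; rewrite /nrm2 /= sqrrN.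
Qed.

Let Lr n : seq R := [seq x%:~R | x <- Lm n].

Let Lr_uniq n : uniq (Lr n).
Proof. by rewrite map_inj_uniq//; exact: intr_inj. Qed.

Let Lr_orth n : {in Lr n &, forall l l', l != l' -> mucf mu (l - l') = 0}.
Proof.
move=> _ _ /mapP[x xn ->] /mapP[y yn ->] xy; apply: (mucf_orth xn yn).
by apply: contraNneq xy => ->.
Qed.

(** Bessel's inequality: the squared norm of a residual is nonnegative. *)
Lemma bessel_mucf (t : R) n : \sum_(l <- Lm n) nrm2 (mucf mu (t - l%:~R)) <= 1.
Proof.
have [_ e] := residual_nrm2 (mu := mu) t (Lr_uniq n) (@Lr_orth n).
rewrite big_map in e; rewrite -subr_ge0 -e; apply: Rintegral_ge0 => x _.
exact: nrm2_ge0.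
Qed.

Let Lm_split m n (F : int -> R) : (n <= m)%N ->
  \sum_(l <- Lm m) F l = \sum_(l <- Lm n) F l + \sum_(l <- Lm m | l \notin Lm n) F l.
Proof.
move=> nm; rewrite (bigID (fun l => l \in Lm n)) /=; congr (_ + _).
rewrite -big_filter; apply: perm_big; apply: uniq_perm; rewrite ?filter_uniq//.
move=> l; rewrite mem_filter; case: (boolP (l \in Lm n)) => //= ln.
exact: (Lm_sub nm).
Qed.

(** * Lower bounds for the tails and the Parseval identity *)

Variables (e d : R).
Hypothesis e_gt0 : 0 < e.
Hypothesis d_gt0 : 0 < d.
Hypothesis tail_lower : forall M, exists2 s, (M <= s)%N &
  forall m x, `|x| <= 1/2 + d -> e <= nrm2 (muhat N B s m x).

Let Pn_ge n : (n.+1%:R : R) <= (Pn N n)%:~R.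
Proof.
elim: n => [|n IH]; first by rewrite /Pn big_ord0.
rewrite PnS intrM.
have N2 : 2 <= (N n)%:~R :> R by rewrite (ler_int _ 2).
have : 1 <= n.+1%:R :> R by rewrite ler1n.
rewrite -[in X in _ -> X]natr1; nra.
Qed.

Lemma nrm2_muhat_le_mucf (t : R) M : exists2 m, (M <= m)%N &
  {in Lm m, forall l : int, e * nrm2 (muhat N B 0 m (l%:~R - t)) <=
    nrm2 (mucf mu (t - l%:~R))}.
Proof.
(* As P_m >= m + 1 > |t| / d, the shift by t changes l / P_m, which lies in [-1/2, 1/2], by at most
   d. *)
pose K := maxn M (Num.truncn (`|t| / d)).
have [m Km Hm] := tail_lower K; exists m.
  by rewrite (leq_trans _ Km)// leq_maxl.
move=> l lm; rewrite nrm2_mucf_sym.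
have P0 : 0 < (Pn N m)%:~R :> R by rewrite ltr0z Pn_gt0.
have tP : `|t| / (Pn N m)%:~R <= d.
  rewrite ler_pdivrMr// mulrC -ler_pdivrMr//.
  apply: le_trans (Pn_ge m); apply/ltW/(lt_le_trans (truncnS_gt _)).
  by rewrite ler_nat ltnS (leq_trans _ Km)// leq_maxr.
have lP : `|(l%:~R : R)| / (Pn N m)%:~R <= 1 / 2.
  have /andP[l1 l2] := Lam_bound N_gt0 lm.
  rewrite ler_pdivrMr// ler_norml; apply/andP; split.
    have : - (Pn N m)%:~R <= 2 * l%:~R :> R by rewrite -mulrNz -(intrM _ 2) ler_int.
    lra.
  have : 2 * l%:~R <= (Pn N m)%:~R :> R by rewrite -(intrM _ 2) ler_int ltW.
  lra.
have xd : `|(l%:~R - t) / (Pn N m)%:~R| <= 1 / 2 + d.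
  rewrite normrM normfV (gtr0_norm P0); apply: le_trans (lerD lP tP).
  by rewrite -mulrDl ler_pM2r ?invr_gt0// ler_normB.
have cv := @nrm2_muhat_cvg (l%:~R - t).
rewrite -(cvg_lim _ cv)//; apply: limr_ge; first exact: cvgP cv.
(* The transform of every longer convolution is that of mu_m times a tail transform, bounded below
   uniformly in the length of the tail. *)
exists m => // k /= mk; rewrite -(subnKC mk) muhat_cat nrm2M mulrC.
by rewrite ler_wpM2l ?nrm2_ge0// Hm.
Qed.

(** The Parseval sum of mu_m, equal to 1, splits over [Lm n] and the rest. With S_n the sum for mu
    over [Lm n], the first part tends to S_n as m grows, and the second is at most (S_m - S_n) / e,
    small once S_n is near its limit. *)
Lemma parseval_mucf (t h : R) : 0 < h ->
  exists n, 1 - \sum_(l <- Lm n) nrm2 (mucf mu (t - l%:~R)) <= h.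
Proof.
move=> h0; pose q (l : int) := nrm2 (mucf mu (t - l%:~R)).
pose S n := \sum_(l <- Lm n) q l.
have q0 l : 0 <= q l by exact: nrm2_ge0.
have Smono : nondecreasing_seq S.
  move=> n m nm; rewrite /S (Lm_split _ nm) lerDl; exact: sumr_ge0.
have Scv : cvgn S.
  apply: nondecreasing_is_cvgn => //; exists 1 => _ [n _ <-]; exact: bessel_mucf.
have Sle := nondecreasing_cvgn_le Smono Scv.
have [n Hn] : exists n, limn S - S n <= e * (h / 2).
  have eh : 0 < e * (h / 2) by rewrite mulr_gt0// divr_gt0.
  have /cvgrPdist_lt /(_ _ eh) [n _ Hn] : S @ \oo --> limn S by [].
  by exists n; have := Hn n (leqnn n) => /ltW; apply: le_trans; exact: ler_norm.
exists n; rewrite -/(S n).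
have sumcv (s : seq int) : \sum_(l <- s) nrm2 (muhat N B 0 m (l%:~R - t)) @[m --> \oo] -->
    \sum_(l <- s) q l.
  elim: s => [|l s IH].
    rewrite big_nil (_ : (fun m => _) = cst 0); first exact: cvg_cst.
    by apply/funext => m; rewrite big_nil.
  rewrite big_cons (_ : (fun m => _) = (fun m => nrm2 (muhat N B 0 m (l%:~R - t)) +
      \sum_(l <- s) nrm2 (muhat N B 0 m (l%:~R - t)))).
    by apply: cvgD => //; rewrite /q nrm2_mucf_sym; exact: nrm2_muhat_cvg.
  by apply/funext => m; rewrite big_cons.
have h20 : 0 < h / 2 by rewrite divr_gt0.
have /cvgrPdist_lt /(_ _ h20) [M _ HM] := sumcv (Lm n).
have [m Mm Hm] := nrm2_muhat_le_mucf t (maxn M n).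
have nm : (n <= m)%N by rewrite (leq_trans _ Mm)// leq_maxr.
have {HM} : \sum_(l <- Lm n) nrm2 (muhat N B 0 m (l%:~R - t)) <= S n + h / 2.
  have := HM m (leq_trans (leq_maxl _ _) Mm) => /=.
  by rewrite distrC => /(le_lt_trans (ler_norm _)); rewrite ltrBlDr addrC => /ltW.
have one : \sum_(l <- Lm m) nrm2 (muhat N B 0 m (l%:~R - t)) = 1.
  rewrite -[RHS](Lam_parseval N_gt0 L_pars m (- t)); apply: eq_bigr => l _.
  by rewrite addrC.
have rest : e * \sum_(l <- Lm m | l \notin Lm n) nrm2 (muhat N B 0 m (l%:~R - t)) <= S m - S n.
  rewrite /S (Lm_split q nm) [X in _ <= X - _]addrC addrK mulr_sumr.
  by rewrite big_seq_cond [leRHS]big_seq_cond; apply: ler_sum => l /andP[lm _]; exact: Hm.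
have Sm : e * \sum_(l <- Lm m | l \notin Lm n) nrm2 (muhat N B 0 m (l%:~R - t)) <= e * (h / 2).
  by apply: (le_trans rest); have := Sle m; lra.
rewrite ler_pM2l// in Sm.
move: one; rewrite (Lm_split _ nm); lra.
Qed.

Lemma spectrum_spectral : spectral mu.
Proof.
pose Lambda : set R := [set l | exists n (x : int), x \in Lm n /\ l = x%:~R].
have Lc : countable Lambda.
  apply: (card_le_trans (B := (fun x : int => x%:~R : R) @` setT)).
    by apply: subset_card_le => _ [n [x [_ ->]]]; exists x.
  exact: card_le_trans (card_image_le _ _) (countableP _).
have ei t := cbounded_integrable mu (expch_bounded t).
have fineE t : (\int[mu]_x (cos (2 * pi * t * x))%:E = (complex.Re (mucf mu t))%:E)%E /\
    (\int[mu]_x (sin (2 * pi * t * x))%:E = (complex.Im (mucf mu t))%:E)%E.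
  have [i1 i2] := ei t.
  by split; [rewrite -[LHS]fineK//; exact: (integrable_fin_num measurableT i1)|
             rewrite -[LHS]fineK//; exact: (integrable_fin_num measurableT i2)].
exists Lambda; split => //; split.
  move=> _ _ [n [x [xn ->]]] [m [y [ym ->]]].
  have [-> ->] := fineE (x%:~R - y%:~R).
  case: eqP => [->|/eqP xy]; first by rewrite subrr mucf0.
  rewrite (@mucf_orth (maxn n m))//.
  - by apply: Lm_sub xn; rewrite leq_maxl.
  - by apply: Lm_sub ym; rewrite leq_maxr.
  - by apply: contraNneq xy => ->.
move=> u v mu_ mv u2 v2 uv.
(* Parseval at an arbitrary t makes the residuals small, so orthogonality to the spectrum extends to
   every character. *)
have all0 t : cintegral mu (fun x => Complex (u x) (v x) * expch t x) = 0.
  apply: orthogonal_expch => // h h0; have [n Hn] := parseval_mucf t h0.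
  exists (Lr n); split => //; last by rewrite big_map.
  move=> _ /mapP[x xn ->].
  have [e1 e2] : _ /\ _ := uv x%:~R (ex_intro _ n (ex_intro _ x (conj xn erefl))).
  by rewrite /cintegral /Rintegral /expch /cexpi /= e1 e2.
have ui := integrable_of_sqr mu_ u2; have vi := integrable_of_sqr mv v2.
have ci (w : R -> R) t : mu.-integrable setT (EFin \o w) ->
    mu.-integrable setT (EFin \o (fun x => w x * cos (2 * pi * t * x))) /\
    mu.-integrable setT (EFin \o (fun x => w x * sin (2 * pi * t * x))).
  move=> wi; have [m1 m2 _] := expch_bounded t.
  by split; [apply: (integrable_bounded_mul (C := 1) wi m1) => x; exact: cos_max|
             apply: (integrable_bounded_mul (C := 1) wi m2) => x; exact: sin_max].
(* The relations at t and - t together separate u from v and cosine from sine. *)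
have zero t : [/\ \int[mu]_x (u x * cos (2 * pi * t * x)) = 0,
    \int[mu]_x (u x * sin (2 * pi * t * x)) = 0,
    \int[mu]_x (v x * cos (2 * pi * t * x)) = 0 &
    \int[mu]_x (v x * sin (2 * pi * t * x)) = 0].
  have [uc us] := ci u t ui; have [vc vs] := ci v t vi.
  have := all0 t; have := all0 (- t); rewrite /cintegral => -[r1 i1] [r2 i2].
  have {}r1 : \int[mu]_x (1 * (u x * cos (2 * pi * t * x)) + 1 * (v x * sin (2 * pi * t * x))) = 0.
    rewrite -[RHS]r1; apply: eq_Rintegral => x _.
    by rewrite /expch /cexpi /= !(mulrN, mulNr, cosN, sinN); ring.
  have {}i1 : \int[mu]_x (-1 * (u x * sin (2 * pi * t * x)) + 1 * (v x * cos (2 * pi * t * x))) = 0.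
    rewrite -[RHS]i1; apply: eq_Rintegral => x _.
    by rewrite /expch /cexpi /= !(mulrN, mulNr, cosN, sinN); ring.
  have {}r2 : \int[mu]_x (1 * (u x * cos (2 * pi * t * x)) + (-1) * (v x * sin (2 * pi * t * x))) = 0.
    rewrite -[RHS]r2; apply: eq_Rintegral => x _.
    by rewrite /expch /cexpi /=; ring.
  have {}i2 : \int[mu]_x (1 * (u x * sin (2 * pi * t * x)) + 1 * (v x * cos (2 * pi * t * x))) = 0.
    rewrite -[RHS]i2; apply: eq_Rintegral => x _.
    by rewrite /expch /cexpi /=; ring.
  rewrite (integrable_lin _ _ uc vs).2 in r1; rewrite (integrable_lin _ _ us vc).2 in i1.
  rewrite (integrable_lin _ _ uc vs).2 in r2; rewrite (integrable_lin _ _ us vc).2 in i2.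
  by split; lra.
have pi2 : (2 * pi : R) != 0 by rewrite mulf_neq0// gt_eqF// pi_gt0.
have hat0 (a x : R) : a * x = 2 * pi * (a / (2 * pi)) * x.
  by rewrite [2 * pi * (a / _)]mulrC divfK.
have u0 : {ae mu, forall x, u x = 0}.
  apply: fourier_unique => // a; have [z1 z2 _ _] := zero (a / (2 * pi)).
  by split; [rewrite -[RHS]z1|rewrite -[RHS]z2]; apply: eq_Rintegral => x _; rewrite (hat0 a x).
have v0 : {ae mu, forall x, v x = 0}.
  apply: fourier_unique => // a; have [_ _ z1 z2] := zero (a / (2 * pi)).
  by split; [rewrite -[RHS]z1|rewrite -[RHS]z2]; apply: eq_Rintegral => x _; rewrite (hat0 a x).
by apply: filterS2 u0 v0 => x.
Qed.

End Spectrum.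

(** * Existence and spectrality combined *)

Unset Implicit Arguments.

Theorem theorem2p5 (R : realType) (N : nat -> int) (B : nat -> seq int) :
  (forall n, admissible R (N n) (B n)) ->
  (forall n, 0 < N n) ->
  cvg (series (fun n => ((rem_card (N n) (B n))%:R / (size (B n))%:R : R)) @ \oo) ->
  (exists nk : nat -> nat, (forall k, (nk k < nk k.+1)%N) /\
     PCC R (fun k => N (nk k)) (fun k => B (nk k))) ->
  exists mu : probability R R,
    infinite_convolution_is N B mu /\ spectral mu.
Proof.
move=> adm N_gt0 rem_cvg [nk [nk_lt pcc]].
have N_ge2 n : 2 <= N n.
  have [N1 _] := adm n; have := N_gt0 n; move: N1.
  by case: (N n) => // k; rewrite gtr0_norm.
have B_ge2 n : (2 <= size (B n))%N by have [_ [_ []]] := adm n.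
have B_gt0 n : (0 < size (B n))%N by exact: ltnW.
have B_uniq n : uniq (B n) by have [_ []] := adm n.
have [mu mu_conv] := infinite_convolution_exists N_ge2 B_gt0 rem_cvg.
exists mu; split => //.
have [L HL] := choice (fun n => admissible_parseval (adm n)).
have L0 n : 0 \in L n by case: (HL n).
have L_pars n : forall x : R, \sum_(l <- L n) nrm2 (mhat (B n) (x + l%:~R / (N n)%:~R)) = 1.
  by case: (HL n).
have [e [d [e0 d0 low]]] := muhat_lower N_ge2 B_ge2 B_uniq rem_cvg nk_lt pcc.
exact: (spectrum_spectral N_ge2 B_gt0 mu_conv L0 L_pars e0 d0 low).
Qed.
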